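(* Let $n$ be a positive integer, let $Q_n$ be the number of $\mathbb{Z}_2^n$-equivariant homeomorphism classes of small covers over the $n$-cube $I^n$, and let $R_k$ be the number of acyclic digraphs with $k$ labeled nodes (with $R_0=1$). Then $$Q_n=\frac{\sum_{k=0}^n\binom{n}{k}2^{k(n-k)}R_k}{2^n\,n!}\cdot\prod_{i=0}^{n-1}(2^n-2^i).$$
   Context: $\mathbb{Z}_2$ denotes the group (field) with two elements. Digraphs: a digraph on labeled nodes $1,\dots,k$ has at most one edge directed from vertex $i$ to vertex $j$, for each $1\le i\le k$, $1\le j\le k$. It is acyclic if it has no directed cycle of any length (in particular no loops and no directed 2-cycles). Acyclic digraphs with labeled nodes are counted without identifying isomorphic ones. Small covers: let $P$ be a simple convex polytope of dimension $n$ (here $P=I^n$). The standard action of $\mathbb{Z}_2^n$ on $\mathbb{R}^n$ is by sign changes of the coordinates; a $\mathbb{Z}_2^n$-action on an $n$-manifold is locally standard if it is locally isomorphic, up to an automorphism of $\mathbb{Z}_2^n$, to the standard action. A small cover over $P$ is a smooth closed manifold $M$ of dimension $n$ with a locally standard $\mathbb{Z}_2^n$-action whose orbit space is $P$ (identified as a manifold with corners). Equivariant homeomorphism: two small covers $M_1,M_2$ over $P$ are $\mathbb{Z}_2^n$-equivariantly homeomorphic if there is a homeomorphism $f:M_1\to M_2$ with $f(t\cdot x)=t\cdot f(x)$ for all $t\in\mathbb{Z}_2^n$, $x\in M_1$ (the induced map on the orbit space $P$ need not be the identity). *)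

(* Defs.v *)
From HB Require Import structures.
From mathcomp Require Import all_boot all_order all_algebra.
From mathcomp Require Import all_classical all_reals all_analysis.

Set Implicit Arguments.
Unset Strict Implicit.
Unset Printing Implicit Defensive.

Import Order.TTheory GRing.Theory Num.Theory.
Import numFieldNormedType.Exports.

Local Open Scope classical_set_scope.
Local Open Scope ring_scope.

(* A digraph on 'I_k is its set of edges, a set of ordered pairs.  A directed
   cycle visits pairwise distinct vertices; a loop is a cycle of length 1. *)
Definition has_edge (k : nat) (E : {set 'I_k * 'I_k}) : rel 'I_k :=
  fun i j => (i, j) \in E.

Definition acyclic_digraph (k : nat) (E : {set 'I_k * 'I_k}) : Prop :=
  forall c : seq 'I_k, ucycle (has_edge E) c -> c = [::].

Definition num_acyclic_digraphs (k : nat) : nat :=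
  #|[set E : {set 'I_k * 'I_k} | `[< acyclic_digraph E >]]%SET|.

(* C^k on an open set A, by recursion on the partial derivatives; openness of A
   is ensured where this is used. *)
Fixpoint Ck_on (R : realType) (n k : nat) (A : set 'rV[R]_n)
    (f : 'rV[R]_n -> R^o) : Prop :=
  (forall x, A x -> {for x, continuous f}) /\
  (if k is k'.+1 then
     forall i : 'I_n,
       (forall x, A x -> derivable f x ('e_i : 'rV[R]_n)) /\
       Ck_on k' A ('D_('e_i : 'rV[R]_n) f)
   else True).

Definition smooth_on (R : realType) (n m : nat) (A : set 'rV[R]_n)
    (f : 'rV[R]_n -> 'rV[R]_m) : Prop :=
  forall (j : 'I_m) (k : nat), Ck_on k A (fun x => f x 0 j).

(* A homeomorphism between open subsets of M and of R^n; the values of the two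
   maps outside of these subsets are irrelevant. *)
Record chart (R : realType) (n : nat) (M : topologicalType) := Chart {
  chart_dom : set M;
  chart_cod : set 'rV[R]_n;
  chart_map : M -> 'rV[R]_n;
  chart_inv : 'rV[R]_n -> M;
  chart_dom_open : open chart_dom;
  chart_cod_open : open chart_cod;
  chart_map_cod : forall x, chart_dom x -> chart_cod (chart_map x);
  chart_inv_dom : forall y, chart_cod y -> chart_dom (chart_inv y);
  chart_mapK : forall x, chart_dom x -> chart_inv (chart_map x) = x;
  chart_invK : forall y, chart_cod y -> chart_map (chart_inv y) = y;
  chart_map_cont : forall x, chart_dom x -> {for x, continuous chart_map};
  chart_inv_cont : forall y, chart_cod y -> {for y, continuous chart_inv} }.

Definition smooth_transition (R : realType) (n : nat) (M : topologicalType)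
    (c d : chart R n M) : Prop :=
  smooth_on (chart_cod c `&` chart_inv c @^-1` chart_dom d)
            (chart_map d \o chart_inv c).

Record smooth_manifold (R : realType) (n : nat) := SmoothManifold {
  mfd_space :> topologicalType;
  mfd_hausdorff : hausdorff_space mfd_space;
  mfd_second_countable : @second_countable mfd_space;
  mfd_atlas : set (chart R n mfd_space);
  mfd_cover : forall x : mfd_space, exists2 c, mfd_atlas c & chart_dom c x;
  mfd_smooth : forall c d, mfd_atlas c -> mfd_atlas d -> smooth_transition c d }.

(* The charts of the maximal atlas, i.e. the diffeomorphisms between open
   subsets of M and of R^n. *)
Definition smooth_chart (R : realType) (n : nat) (M : smooth_manifold R n)
    (c : chart R n M) : Prop :=
  forall d, mfd_atlas d -> smooth_transition c d /\ smooth_transition d c.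

(* Z_2^n is the additive group of 'rV['F_2]_n. *)
Record Z2_action (n : nat) (M : topologicalType) := Z2Action {
  act :> 'rV['F_2]_n -> M -> M;
  act0 : forall x, act 0 x = x;
  actD : forall s t x, act (s + t) x = act s (act t x);
  act_continuous : forall t, continuous (act t) }.

Definition standard_act (R : realType) (n : nat) (t : 'rV['F_2]_n)
    (x : 'rV[R]_n) : 'rV[R]_n :=
  \row_i (if t 0 i == 0 then x 0 i else - x 0 i).

(* A smooth chart on an invariant open set, equivariant up to an automorphism
   of Z_2^n; its codomain is then invariant under the standard action. *)
Definition standard_chart (R : realType) (n : nat) (M : smooth_manifold R n)
    (a : Z2_action n M) (c : chart R n M) : Prop :=
  smooth_chart c /\
  exists alpha : {additive 'rV['F_2]_n -> 'rV['F_2]_n},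
    bijective alpha /\
    forall t x, chart_dom c x ->
      chart_dom c (a t x) /\
      chart_map c (a t x) = standard_act (alpha t) (chart_map c x).

Definition locally_standard (R : realType) (n : nat) (M : smooth_manifold R n)
    (a : Z2_action n M) : Prop :=
  forall x : M, exists2 c, standard_chart a c & chart_dom c x.

Definition cube (R : realType) (n : nat) : set 'rV[R]_n :=
  [set x | forall i, 0 <= x 0 i <= 1].

(* A point x lies in the relative interior of a face of this codimension. *)
Definition cube_codim (R : realType) (n : nat) (x : 'rV[R]_n) : nat :=
  #|[set i : 'I_n | (x 0 i == 0) || (x 0 i == 1)]%SET|.

(* The orbit space R^n / Z_2^n is the orthant [0, +oo[^n, via the absolute
   values of the coordinates; the image of x has this codimension there. *)
Definition orthant_codim (R : realType) (n : nat) (x : 'rV[R]_n) : nat :=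
  #|[set i : 'I_n | x 0 i == 0]%SET|.

(* p induces a homeomorphism from the orbit space M / Z_2^n onto the cube (the
   first four conditions) that preserves the codimension of every point, hence
   an identification of manifolds with corners; the corner structure of the
   orbit space is the one given by the standard charts. *)
Definition orbit_map_onto_cube (R : realType) (n : nat)
    (M : smooth_manifold R n) (a : Z2_action n M) (p : M -> 'rV[R]_n) : Prop :=
  [/\ continuous p,
      range p = cube (R := R) (n := n),
      forall x y, p x = p y <-> exists t, a t x = y,
      forall V : set 'rV[R]_n, open (p @^-1` V) ->
        exists2 W : set 'rV[R]_n, open W &
          W `&` cube (R := R) (n := n) = V `&` cube (R := R) (n := n) &
      forall c x, standard_chart a c -> chart_dom c x ->
        cube_codim (p x) = orthant_codim (chart_map c x)].

Record small_cover_over_cube (R : realType) (n : nat) := SmallCoverOverCube {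
  sc_mfd :> smooth_manifold R n;
  sc_compact : compact [set: sc_mfd];
  sc_act : Z2_action n sc_mfd;
  sc_locally_standard : locally_standard sc_act;
  sc_orbit_space : exists p : sc_mfd -> 'rV[R]_n, orbit_map_onto_cube sc_act p }.

Definition equivariantly_homeomorphic (R : realType) (n : nat)
    (M N : small_cover_over_cube R n) : Prop :=
  exists (f : M -> N) (g : N -> M),
    [/\ cancel f g, cancel g f, continuous f, continuous g &
        forall t x, f (sc_act M t x) = sc_act N t (f x)].

(* The quotient T / E by the equivalence relation E has exactly m elements:
   cls induces a bijection from T / E onto 'I_m. *)
Definition num_classes (T : Type) (E : T -> T -> Prop) (m : nat) : Prop :=
  exists cls : T -> 'I_m,
    (forall i, exists x, cls x = i) /\
    (forall x y, cls x = cls y <-> E x y).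

(* Main.v *)
Require Import Defs.
From HB Require Import structures.
From mathcomp Require Import all_boot all_order all_algebra all_fingroup.
From mathcomp Require Import ring lra.
From mathcomp Require Import all_classical all_reals all_analysis.

(** A small cover over the cube is determined up to equivariant homeomorphism
by its characteristic function lam.  Over the relative interior of a facet F
all points have the same isotropy group, which has order 2, and lam F is its
generator.  A standard chart shows that the isotropy group over any point y of
the cube is freely generated by the lam F for the facets F through y; at a
vertex this makes the n vectors lam F a basis of Z_2^n ([exists_char_fun]).

Conversely lam determines the small cover, because the orbit map has a
continuous section ([global_section]).  Standard charts give sections over
small boxes.  Two sections over adjacent boxes differ, on the common wall, by a
group element that is locally constant over the interior of the cube, where the
action is free; the wall is convex, so the element is constant and one section
can be corrected by it.  Given a section, the space is the quotient of
Z_2^n x I^n by a relation that lam dictates, so a symmetry of the cube that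
takes one characteristic function to another lifts to an equivariant
homeomorphism ([relabel_homeomorphic]).  In the other direction an equivariant
homeomorphism induces a homeomorphism of the cube that preserves codimension;
it permutes the facets, preserves the pairs of disjoint facets, and so acts on
the facets like a symmetry of the cube ([homeomorphic_relabel]).

Every characteristic function occurs ([model_small_cover]).  The quotient of
Z_2^n x I^n embeds in a Euclidean space by the functions that multiply a
character of Z_2^n by the distances to the facets on which the character is
nontrivial.  Around each vertex the signed distances to the n facets through it
are a chart, and in these charts all transition maps are locally affine.

Hence the classes are the orbits of the symmetry group of the cube, of order
2^n n!, on the characteristic functions, and they are counted by the
Cauchy-Frobenius formula ([card_char_orbits]).  Facets that meet have different
values under lam, so only products of coordinate reflections can fix lam: those
in a set S of directions do when lam agrees on the two facets of each direction
in S.  Take the basis lam (i, false); then the vectors lam (i, true) are the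
rows of 1 + A with A the adjacency matrix of a digraph E on the n directions,
and the basis condition at all 2^n vertices says that E is acyclic
([acyclic_mixed_unit]).  The fixed functions correspond to the E without edges
out of S, of which there are 2^(k(n-k)) R_k for k = n - |S|. *)

Set Implicit Arguments.
Unset Strict Implicit.
Unset Printing Implicit Defensive.

Import Order.TTheory GRing.Theory Num.Theory.

Local Open Scope ring_scope.

(** * Acyclic digraphs and nonsingular matrices over the field with two elements *)

(** The facet (i, b) of the cube is the one on which the i-th coordinate is b. *)
Notation facet n := ('I_n * bool)%type.
Notation char_fun n := {ffun facet n -> 'rV['F_2]_n}.

Definition vertex_mx n (lam : char_fun n) (v : {ffun 'I_n -> bool}) :=
  \matrix_i lam (i, v i).
(** The nondegeneracy condition of Davis and Januszkiewicz: the facets through the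
vertex v are the (i, v i), and their n labels have to form a basis. *)
Definition is_char n (lam : char_fun n) :=
  [forall v : {ffun 'I_n -> bool}, vertex_mx lam v \in unitmx].

Lemma F2_neq0 (a : 'F_2) : (a != 0) = (a == 1).
Proof. by case: a => [[|[|m]] //= Hm]. Qed.

Lemma F2_addxx (a : 'F_2) : a + a = 0.
Proof. by case: a => [[|[|m]] //= Hm]; exact: val_inj. Qed.

Definition adjacency n (E : {set 'I_n * 'I_n}) : 'M['F_2]_n :=
  \matrix_(i, j) ((i, j) \in E)%:R.

(** The rows of 1 + A in the positions where v is true, and those of the identity
elsewhere: its determinant is the principal minor of 1 + A selected by v. *)
Definition mixed_mx n (E : {set 'I_n * 'I_n}) (v : {ffun 'I_n -> bool}) : 'M['F_2]_n :=
  \matrix_i (if v i then row i (1%:M + adjacency E) else row i 1%:M).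

(** A vector u is in the kernel when u i = 0 outside of v and, inside, u i is the
sum of u over the successors of i.  This is what links the kernel to cycles. *)
Lemma mixed_mxE n (E : {set 'I_n * 'I_n}) v (u : 'rV['F_2]_n) i :
  (u *m (mixed_mx E v)^T) 0 i =
  u 0 i + (if v i then \sum_(j | (i, j) \in E) u 0 j else 0).
Proof.
rewrite mxE (eq_bigr (fun j => u 0 j * (i == j)%:R
   + (if v i then u 0 j * ((i, j) \in E)%:R else 0))); last first.
  by move=> j _; rewrite !mxE; case: (v i); rewrite !mxE ?mulrDr ?addr0.
rewrite big_split /=; congr (_ + _).
  rewrite (bigD1 i) //= eqxx mulr1 big1 ?addr0 // => j ji.
  by rewrite eq_sym (negPf ji) mulr0.
case: (v i); last by rewrite big1.
rewrite [RHS]big_mkcond; apply: eq_bigr => j _.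
by case: ((i, j) \in E); rewrite ?mulr1 ?mulr0.
Qed.

(** A shortest cycle works: a chord from x to y would close up the part of the
cycle from y to x to a shorter cycle. *)
Lemma chordless_ucycle (T : finType) (e : rel T) (c : seq T) :
  ucycle e c -> c != [::] ->
  exists c', [/\ ucycle e c', c' != [::] &
    forall x y, x \in c' -> y \in c' -> e x y -> y = next c' x].
Proof.
have [m] := ubnP (size c); elim: m => // m IH in c *; rewrite ltnS => lecm uc c0.
have [/existsP[x /existsP[y /and4P[xc yc exy yN]]]|] :=
  boolP [exists x, exists y, [&& x \in c, y \in c, e x y & y != next c x]]; last first.
  move=> H; exists c; split=> // x y xc yc exy; apply/eqP.
  apply: contraNT H => yN; apply/existsP; exists x; apply/existsP; exists y.
  by rewrite xc yc exy yN.
(* Start the cycle at y: the chord closes it up after x. *)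
have [i c1 defc] := rot_to yc.
have uc1 : ucycle e (y :: c1).
  by case/andP: uc => cc Uc; rewrite /ucycle -defc rot_cycle rot_uniq cc.
have yN1 : y != next (y :: c1) x by rewrite -defc next_rot //; case/andP: uc.
have szc : size c = (size c1).+1 by rewrite -(size_rot i c) defc.
have xc1 : x \in y :: c1 by rewrite -defc mem_rot.
case/splitPl: xc1 uc1 yN1 szc {defc} => p1 p2 lp1 uc1 yN1 szc.
have [q0|q0] := eqVneq p2 [::].
  case/eqP: yN1; rewrite q0 cats0 -lp1.
  case/andP: uc1; rewrite q0 cats0 => _ U1.
  case: (lastP p1) U1 => [|p1' z] U1; first by rewrite /= eqxx.
  rewrite last_rcons; move: U1; rewrite -rcons_cons => U1.
  rewrite -(next_rotr 1) ?rotr1_rcons /= ?eqxx //.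
(* The rest p2 of the cycle is nonempty, so y :: p1 is shorter. *)
have uc' : ucycle e (y :: p1).
  case/andP: uc1 => cc1 U1; apply/andP; split.
    move: cc1 => /=; rewrite rcons_path cat_path => /andP[/andP[pp1 _] _].
    by rewrite rcons_path pp1 /= lp1.
  by move: U1; rewrite -cat_cons cat_uniq => /and3P[].
apply: (IH (y :: p1)) => //=.
have : (size p2 > 0)%N by case: (p2) q0.
move: lecm; rewrite szc size_cat => h1 h2; apply: leq_trans h1; rewrite !ltnS.
by rewrite -[X in (X < _)%N]addn0 ltn_add2l.
Qed.

Definition acyclic (T : finType) (e : rel T) := forall c : seq T, ucycle e c -> c = [::].

(** Follow a choice f of successors inside S: the orbit of x0 under f runs into
itself, and the part from the repeated vertex on is a cycle. *)
Lemma cycle_of_successors (T : finType) (e : rel T) (S : {set T}) x0 :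
  x0 \in S -> (forall x, x \in S -> exists2 y, y \in S & e x y) ->
  exists2 c, ucycle e c & c != [::].
Proof.
move=> x0S succ.
have /choice[f fP] : forall x, exists y, x \in S -> y \in S /\ e x y.
  move=> x; have [xS|xS] := boolP (x \in S); last by exists x0.
  by have [y yS exy] := succ _ xS; exists y.
have fS k : iter k f x0 \in S by elim: k => //= k IH; have [] := fP _ IH.
have orbS : all (mem S) (fingraph.orbit f x0).
  apply/allP => y; rewrite -fconnect_orbit => /connectP[q /fpathP[m ->] ->].
  by rewrite last_traject; apply: fS.
have Uorb := orbit_uniq f x0.
have : f (last x0 (fingraph.orbit f x0)) \in fingraph.orbit f x0.
  rewrite -fconnect_orbit; apply: (@connect_trans _ _ (last x0 (fingraph.orbit f x0))).
    by rewrite fconnect_orbit /fingraph.orbit -orderSpred /= mem_last.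
  exact: fconnect1.
have pf : fpath f x0 (behead (fingraph.orbit f x0)).
  by rewrite /fingraph.orbit -orderSpred; exact: fpath_traject.
move: Uorb orbS pf.
rewrite [fingraph.orbit f x0](_ : _ = x0 :: behead (fingraph.orbit f x0)); last first.
  by rewrite /fingraph.orbit -orderSpred.
move: (behead _) => p U orbS pf /=; move yE: (f _) => y yp.
have [p1 [p2 defp]] : exists p1 p2, x0 :: p = p1 ++ y :: p2.
  by case/splitPr: yp => p1 p2; exists p1, p2.
exists (y :: p2) => //.
apply/andP; split; last by move: U; rewrite defp cat_uniq => /and3P[].
have lst : last x0 p = last y p2.
  by have := congr1 (last x0) defp; rewrite last_cat.
have yf : f (last y p2) = y by rewrite -lst yE.
have sc : fcycle f (y :: p2).
  rewrite /= rcons_path /= yf eqxx andbT.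
  case: p1 defp => [|z p1] /= defp; first by case: defp => <- <-.
  case: defp => _ defp.
  by move: pf; rewrite defp cat_path /= => /and3P[].
apply: (sub_in_cycle (P := mem S)) sc => [u w /= uS wS /eqP<-|].
  by have [] := fP _ uS.
by move: orbS; rewrite defp all_cat => /andP[].
Qed.

(** If u is a nonzero kernel vector, every vertex of its support has a successor in
the support, so there is a cycle.  Conversely the indicator of a chordless
cycle d is in the kernel for v = d: every vertex of d has exactly one successor
in d, and 1 + 1 = 0. *)
Lemma acyclic_mixed_unit n (E : {set 'I_n * 'I_n}) :
  acyclic (has_edge E) <-> forall v, mixed_mx E v \in unitmx.
Proof.
split=> [acE v|uE c uc].
  rewrite -unitmx_tr unitmxE unitfE; apply/det0P => -[u u0 Hu].
  have {Hu} Hu i : u 0 i + (if v i then \sum_(j | (i, j) \in E) u 0 j else 0) = 0.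
    by rewrite -mixed_mxE Hu mxE.
  have [i ui] : exists i, i \in [set i | u 0 i != 0]%SET.
    have /existsP[i ui] : [exists i, u 0 i != 0].
      apply: contraNT u0 => /existsPn H; apply/eqP/rowP => i.
      by have /negPn/eqP-> := H i; rewrite mxE.
    by exists i; rewrite inE.
  have [|c uc /eqP[]] := cycle_of_successors (e := has_edge E) ui; last exact: acE.
  move=> {ui}i; rewrite inE => ui; have := Hu i.
  have [_|vi] := boolP (v i); last by move/eqP; rewrite addr0 (negPf ui).
  move=> Hi; have /existsP[j /andP[ij uj]] : [exists j, ((i, j) \in E) && (u 0 j != 0)].
    apply: contraNT ui => /existsPn H; rewrite -Hi big1 ?addr0 // => j ij.
    by apply/eqP; have := H j; rewrite ij /= negbK.
  by exists j; rewrite ?inE.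
apply/eqP; apply: contraT => c0.
have [d [/[dup] ud /andP[cd Ud] d0 chord]] := chordless_ucycle uc c0.
pose v := [ffun i => i \in d].
suff /negP[] : ~~ (mixed_mx E v \in unitmx) by exact: uE.
rewrite -unitmx_tr unitmxE unitfE negbK; apply/det0P.
exists (\row_i (i \in d)%:R).
  case: d d0 {ud cd Ud chord v} => // i d _; apply/eqP => /rowP/(_ i)/eqP.
  by rewrite !mxE inE eqxx oner_eq0.
apply/rowP => i; rewrite mixed_mxE !mxE ffunE.
have [id|_] := boolP (i \in d); last by rewrite addr0.
rewrite (bigD1 (next d i)) /=; last exact: (next_cycle cd id).
rewrite mxE mem_next id big1 ?addr0 ?F2_addxx // => j /andP[ij jN].
rewrite mxE; have [jd|//] := boolP (j \in d).
by case/eqP: jN; exact: chord.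
Qed.

(** * Acyclic digraphs without edges out of a given set *)

Definition acyclic_without_edges_from n (S : {set 'I_n}) :=
  [set E : {set 'I_n * 'I_n} | `[< acyclic (has_edge E) >]
     && [forall i in S, forall j, (i, j) \notin E]]%SET.

Section Extend.
Variables (n : nat) (S : {set 'I_n}).
Let f (i : 'I_#|~: S|) : 'I_n := enum_val i.

(** A digraph without edges out of S consists of a digraph p.1 on the complement of
S and a set p.2 of edges from the complement of S to S. *)
Definition extend_digraph (p : {set 'I_#|~: S| * 'I_#|~: S|} * {set 'I_n * 'I_n}) :=
  ([set (f ij.1, f ij.2) | ij in p.1] :|: p.2)%SET.

Let fS i : f i \in S = false.
Proof. by have := enum_valP i; rewrite inE => /negPf. Qed.

Let f_inj : injective f. Proof. exact: enum_val_inj. Qed.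

Let f_onto i : i \notin S -> exists j, i = f j.
Proof.
move=> iS; have iS' : i \in ~: S by rewrite inE.
by exists (enum_rank_in iS' i); rewrite /f enum_rankK_in.
Qed.

Section Pair.
Variables (E1 : {set 'I_#|~: S| * 'I_#|~: S|}) (E2 : {set 'I_n * 'I_n}).
Hypothesis E2S : E2 \subset finset.setX (~: S) S.

Lemma extend_digraph_inner i j :
  ((f i, f j) \in extend_digraph (E1, E2)) = ((i, j) \in E1).
Proof.
rewrite inE /= [X in _ || X](_ : _ = false) ?orbF; last first.
  by apply/negP => /(fintype.subsetP E2S); rewrite inE /= fS andbF.
apply/imsetP/idP => [[[k l] kl [/f_inj-> /f_inj->]] //|ij].
by exists (i, j).
Qed.

Lemma extend_digraph_outer i j :
  j \in S -> ((i, j) \in extend_digraph (E1, E2)) = ((i, j) \in E2).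
Proof.
move=> jS; rewrite inE /= [X in X || _](_ : _ = false) //.
by apply/negP => /imsetP[[k l] _ [_ jl]]; rewrite jl fS in jS.
Qed.

Lemma extend_digraph_from i j : i \in S -> (i, j) \notin extend_digraph (E1, E2).
Proof.
move=> iS; rewrite inE negb_or; apply/andP; split.
  by apply/negP => /imsetP[[k l] _ [ik _]]; rewrite ik fS in iS.
by apply/negP => /(fintype.subsetP E2S); rewrite !inE /= iS.
Qed.

(** A cycle never visits S, because no edge leaves S. *)
Lemma acyclic_extend :
  acyclic (has_edge (extend_digraph (E1, E2))) <-> acyclic (has_edge E1).
Proof.
have pre : relpre f (has_edge (extend_digraph (E1, E2))) =2 has_edge E1.
  by move=> i j; rewrite /= /has_edge extend_digraph_inner.
split=> ac c uc.
  have /ac : ucycle (has_edge (extend_digraph (E1, E2))) (map f c).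
    case/andP: uc => cc Uc; rewrite /ucycle cycle_map map_inj_uniq // Uc andbT.
    by rewrite (eq_cycle pre).
  by case: c {uc}.
have cS x : x \in c -> x \notin S.
  move=> xc; apply/negP => xS; have /andP[cc _] := uc.
  have := next_cycle cc xc; apply/negP.
  by rewrite /has_edge; exact: extend_digraph_from.
have [d defc] : exists d, c = map f d.
  elim: c cS {uc} => [|x c IH] cS; first by exists [::].
  have [|d ->] := IH; first by move=> y yc; apply: cS; rewrite inE yc orbT.
  have [|j ->] := @f_onto x; first by apply: cS; rewrite inE eqxx.
  by exists (j :: d).
move: uc; rewrite defc /ucycle cycle_map map_inj_uniq // (eq_cycle pre) => ud.
by rewrite (ac d).
Qed.

End Pair.

(** The edges into S can be chosen freely, the others form an acyclic digraph. *)
Lemma card_acyclic_without_edges_from :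
  #|acyclic_without_edges_from S| =
  (2 ^ (#|~: S| * #|S|) * num_acyclic_digraphs #|~: S|)%N.
Proof.
pose A := [set E : {set 'I_#|~: S| * 'I_#|~: S|} | `[< acyclic (has_edge E) >]]%SET.
pose B := powerset (finset.setX (~: S)%SET S).
have -> : acyclic_without_edges_from S = extend_digraph @: finset.setX A B.
  apply/setP => E; apply/idP/imsetP => [|[[E1 E2]]]; last first.
    rewrite !inE /= => /andP[/asboolP acE1 E2S] ->; apply/andP; split.
      by apply/asboolP/acyclic_extend.
    by apply/forall_inP => i iS; apply/forallP => j; exact: extend_digraph_from.
  rewrite inE => /andP[/asboolP acE /forall_inP noE].
  have nE i j : i \in S -> (i, j) \in E = false.
    by move=> /noE/forallP/(_ j)/negPf.
  pose E1 := [set ij : 'I_#|~: S| * 'I_#|~: S| | (f ij.1, f ij.2) \in E]%SET.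
  pose E2 := (E :&: finset.setX [set: _] S)%SET.
  have E2S : E2 \subset finset.setX (~: S)%SET S.
    apply/fintype.subsetP => -[i j]; rewrite !inE /= => /andP[ijE ->]; rewrite andbT.
    by apply/negP => iS; rewrite nE in ijE.
  have defE : E = extend_digraph (E1, E2).
    apply/setP => -[i j]; have [iS|iS] := boolP (i \in S).
      by rewrite nE // (negPf (extend_digraph_from _ _ _ _)).
    have [jS|jS] := boolP (j \in S).
      by rewrite extend_digraph_outer // !inE /= jS andbT.
    have [k ->] := f_onto iS; have [l ->] := f_onto jS.
    by rewrite extend_digraph_inner // inE.
  exists (E1, E2); rewrite // !inE /= E2S andbT.
  by apply/asboolP/(acyclic_extend _ E2S); rewrite -defE.
rewrite card_in_imset => [|[E1 E2] [F1 F2]]; last first.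
  rewrite !inE /= => /andP[_ E2S] /andP[_ F2S] /setP eEF.
  congr pair; apply/setP => -[i j].
    by have := eEF (f i, f j); rewrite !extend_digraph_inner.
  have [jS|jS] := boolP (j \in S).
    by have := eEF (i, j); rewrite !extend_digraph_outer.
  transitivity false; [|symmetry]; apply/negP.
    by move/(fintype.subsetP E2S); rewrite inE /= (negPf jS) andbF.
  by move/(fintype.subsetP F2S); rewrite inE /= (negPf jS) andbF.
by rewrite cardsX card_powerset cardsX mulnC.
Qed.

End Extend.

(** * Counting characteristic functions up to the symmetries of the cube *)

Definition units_mx n := [set A : 'M['F_2]_n | A \in unitmx]%SET.

Lemma card_units_mx n : (0 < n)%N ->
  #|units_mx n| = (\prod_(0 <= i < n) (2 ^ n - 2 ^ i))%N.
Proof.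
move=> n0; transitivity #|'GL_n['F_2]%g|.
  case: n n0 => // n _; rewrite cardsT /= card_sub.
  by apply: eq_card => A; rewrite !inE.
rewrite card_GL // card_Fp // -bin2_sum expn_sum big_add1 /=.
rewrite [X in (_ * X)%N]big_nat_rev -big_split /= big_nat [RHS]big_nat.
apply: eq_bigr => i /andP[_ lin].
by rewrite add0n mulnBr muln1 -expnD subnSK // subnKC // ltnW.
Qed.

(** The characteristic functions in terms of the basis p.1 at the vertex 0 and of
the coefficients 1 + A of the opposite facets in this basis. *)
Definition char_fun_of n (p : 'M['F_2]_n * {set 'I_n * 'I_n}) : char_fun n :=
  [ffun F => if F.2 then row F.1 ((1%:M + adjacency p.2) *m p.1) else row F.1 p.1].

Lemma vertex_mx_char_fun_of n (p : 'M['F_2]_n * {set 'I_n * 'I_n}) v :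
  vertex_mx (char_fun_of p) v = mixed_mx p.2 v *m p.1.
Proof.
apply/row_matrixP => i; rewrite row_mul !rowK ffunE /=.
by case: (v i); rewrite -row_mul ?mul1mx.
Qed.

Lemma is_char_char_fun_of n (A : 'M['F_2]_n) E :
  is_char (char_fun_of (A, E)) = (A \in unitmx) && `[< acyclic (has_edge E) >].
Proof.
apply/forallP/andP => [uv|[uA /asboolP/acyclic_mixed_unit uE] v]; last first.
  by rewrite vertex_mx_char_fun_of unitmx_mul uE.
split; last apply/asboolP/acyclic_mixed_unit => v.
  by have := uv [ffun=> false]; rewrite vertex_mx_char_fun_of unitmx_mul => /andP[].
by have := uv v; rewrite vertex_mx_char_fun_of unitmx_mul => /andP[].
Qed.

Lemma char_fun_ofP n (lam : char_fun n) : is_char lam -> exists p, lam = char_fun_of p.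
Proof.
move=> /forallP uv.
pose A := vertex_mx lam [ffun=> false]; pose B := vertex_mx lam [ffun=> true].
have uA : A \in unitmx by exact: uv.
exists (A, [set ij | (B *m invmx A - 1%:M) ij.1 ij.2 != 0]%SET).
have -> : char_fun_of (A, [set ij | (B *m invmx A - 1%:M) ij.1 ij.2 != 0]%SET)
   = [ffun F => if F.2 then row F.1 B else row F.1 A].
  apply/ffunP => -[i b]; rewrite !ffunE /=; case: b => //; congr row.
  rewrite [adjacency _](_ : _ = B *m invmx A - 1%:M).
    by rewrite addrC subrK mulmxKV.
  apply/matrixP => j k; rewrite mxE inE /=; case: eqVneq => [-> //|].
  by rewrite F2_neq0 => /eqP->.
by apply/ffunP => -[i []]; rewrite ffunE /= rowK ffunE.
Qed.

Lemma char_fun_of_inj n (A B : 'M['F_2]_n) E D : A \in unitmx ->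
  char_fun_of (A, E) = char_fun_of (B, D) -> (A, E) = (B, D).
Proof.
move=> uA /ffunP eAB.
have {}eAB i : row i A = row i B /\
    row i ((1%:M + adjacency E) *m A) = row i ((1%:M + adjacency D) *m B).
  by split; [have := eAB (i, false) | have := eAB (i, true)]; rewrite !ffunE.
have AB : A = B by apply/row_matrixP => i; have [] := eAB i.
congr pair => //; rewrite -AB in eAB.
have /(can_inj (mulmxK uA)) /addrI/matrixP eED :
  (1%:M + adjacency E) *m A = (1%:M + adjacency D) *m A.
  by apply/row_matrixP => i; have [] := eAB i.
apply/setP => -[i j]; have := eED i j; rewrite !mxE.
by case: (_ \in E) (_ \in D) => [] [].
Qed.

(** The characteristic functions fixed by the reflections in the directions of S. *)
Definition reflected_char n (S : {set 'I_n}) :=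
  [set lam : char_fun n | is_char lam &&
    [forall i in S, lam (i, false) == lam (i, true)]]%SET.

(** In terms of the digraph the condition says that the rows of its adjacency
matrix in S vanish. *)
Lemma card_reflected_char n (S : {set 'I_n}) :
  #|reflected_char S| =
  (#|units_mx n| * (2 ^ (#|~: S| * #|S|) * num_acyclic_digraphs #|~: S|))%N.
Proof.
rewrite -card_acyclic_without_edges_from -cardsX.
have refl (p : 'M['F_2]_n * {set 'I_n * 'I_n}) : p.1 \in unitmx ->
    [forall i in S, char_fun_of p (i, false) == char_fun_of p (i, true)]
    = [forall i in S, forall j, (i, j) \notin p.2].
  move=> uA; apply: eq_forallb => i; congr (_ ==> _).
  rewrite !ffunE /= row_mul linearD /= row1 mulmxDl -rowE.
  rewrite eq_sym -subr_eq0 addrC addKr; apply/eqP/forallP => [r0 j|r0].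
    have /rowP/(_ j) : row i (adjacency p.2) = 0.
      by rewrite -(mulmxK uA (row i _)) r0 mul0mx.
    by rewrite !mxE; case: (_ \in _).
  rewrite [row i _](_ : _ = 0) ?mul0mx //; apply/rowP => j.
  by rewrite !mxE (negPf (r0 j)).
rewrite [reflected_char S](_ : _ = @char_fun_of n @: finset.setX (units_mx n)
    (acyclic_without_edges_from S)).
  rewrite card_in_imset // => -[A E] [B D]; rewrite inE /= => /andP[].
  by rewrite inE => uA _ _; apply: char_fun_of_inj.
apply/setP => lam; apply/idP/imsetP => [|[[A E]]]; last first.
  rewrite !inE /= => /andP[uA /andP[acE noE]] ->.
  by rewrite is_char_char_fun_of uA acE refl.
rewrite inE => /andP[/[dup] clam /char_fun_ofP[[A E] defl]].
move: clam; rewrite defl is_char_char_fun_of => /andP[uA acE].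
by rewrite refl // => noE; exists (A, E); rewrite // !inE /= uA acE.
Qed.

Definition opposite_fun n (F : facet n) : facet n := (F.1, ~~ F.2).
Lemma opposite_funK n : involutive (@opposite_fun n).
Proof. by case=> i b; rewrite /opposite_fun /= negbK. Qed.
Definition opposite n : {perm facet n} := perm (inv_inj (@opposite_funK n)).
(** A permutation of the facets comes from a symmetry of the cube exactly when it
preserves the pairs of opposite facets. *)
Definition cube_aut n : {group {perm facet n}} := 'C[opposite n]%G.

Lemma cube_autP n (s : {perm facet n}) :
  reflect (forall F, s (opposite_fun F) = opposite_fun (s F)) (s \in cube_aut n).
Proof.
apply: (iffP cent1P) => [/permP com F|com]; last first.
  by apply/permP => F; rewrite !permM !permE com.
by have := com F; rewrite !permM !permE.
Qed.

Lemma wreath_fun_inj n (q : {set 'I_n} * {perm 'I_n}) :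
  injective (fun F : facet n => (q.2 F.1, F.2 (+) (F.1 \in q.1))).
Proof. by move=> [i b] [j c] [/= /perm_inj -> /addIb ->]. Qed.
(** The set q.1 tells which coordinates are reflected, before q.2 permutes them. *)
Definition wreath n (q : {set 'I_n} * {perm 'I_n}) : {perm facet n} :=
  perm (@wreath_fun_inj n q).

Lemma wreath_aut n (q : {set 'I_n} * {perm 'I_n}) : wreath q \in cube_aut n.
Proof.
by apply/cube_autP => -[i b]; rewrite !permE /opposite_fun /= addNb.
Qed.

Lemma wreath_inj n : injective (@wreath n).
Proof.
move=> [S s] [T t] /permP e; congr pair.
  by apply/setP => i; have := e (i, false); rewrite !permE /= => -[_ ->].
by apply/permP => i; have := e (i, false); rewrite !permE /= => -[].
Qed.

Lemma cube_aut_wreath n (s : {perm facet n}) : s \in cube_aut n ->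
  exists q, s = wreath q.
Proof.
move/cube_autP => com.
have s1 i b : s (i, b) = ((s (i, false)).1, b (+) (s (i, false)).2).
  by case: b; [have := com (i, false) => -> | case: (s _)].
have inj : injective (fun i => (s (i, false)).1).
  move=> i j eij; have [b eb] : exists b, s (i, b) = s (j, false).
    exists ((s (i, false)).2 (+) (s (j, false)).2).
    by rewrite s1 eij addbC addbA addbb addFb; case: (s _).
  by have /perm_inj[] := eb.
exists ([set i | (s (i, false)).2]%SET, perm inj).
by apply/permP => -[i b]; rewrite s1 !permE /= inE.
Qed.

Lemma card_cube_aut n : #|cube_aut n| = (2 ^ n * n`!)%N.
Proof.
have -> : cube_aut n = @wreath n @: [set: _] :> {set _}.
  apply/setP => s; apply/idP/imsetP => [/cube_aut_wreath[q ->]|[q _ ->]].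
    by exists q.
  exact: wreath_aut.
rewrite card_imset; last exact: wreath_inj.
by rewrite cardsT card_prod card_Sn -cardsT -powersetT card_powerset cardsT card_ord.
Qed.

(** The inverse makes this a right action, as permutations are composed from left to
right. *)
Definition relabel n (lam : char_fun n) (s : {perm facet n}) : char_fun n :=
  [ffun F => lam (s^-1 F)%g].

Lemma relabel_is_action n : is_action [set: {perm facet n}] (@relabel n).
Proof.
split=> [s lam mu /ffunP e|lam s t _ _].
  by apply/ffunP => F; have := e (s F); rewrite !ffunE permK.
by apply/ffunP => F; rewrite !ffunE invMg permM.
Qed.
Canonical relabel_action n := Action (@relabel_is_action n).

Definition char_funs n := [set lam : char_fun n | is_char lam]%SET.

Lemma relabel_char n (lam : char_fun n) s :
  s \in cube_aut n -> is_char lam -> is_char (relabel lam s).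
Proof.
rewrite -groupV => /cube_aut_wreath[[S t] defs] /forallP ch; apply/forallP => v.
pose w := [ffun i => v ((t^-1)%g i) (+) ((t^-1)%g i \in S)].
have -> : vertex_mx (relabel lam s) v = row_perm t (vertex_mx lam w).
  by apply/matrixP => i j; rewrite !mxE !ffunE defs permE /= permK.
by rewrite row_permE unitmx_mul unitmx_perm ch.
Qed.

Lemma cube_aut_acts n : [acts cube_aut n, on char_funs n | relabel_action n]%act.
Proof.
apply/fintype.subsetP => s sA; rewrite inE finset.in_setT /= inE.
by apply/fintype.subsetP => lam; rewrite !inE => ch; apply: relabel_char.
Qed.

(** Two facets in different directions meet in a vertex, where the labels are
linearly independent. *)
Lemma is_char_neq n (lam : char_fun n) F G : is_char lam ->
  F.1 != G.1 -> lam F != lam G.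
Proof.
case: F G => [i b] [j c] /forallP ch /= ij; apply/eqP => e.
pose v := [ffun k => if k == i then b else c].
have : row_free (vertex_mx lam v) by rewrite row_free_unit.
move/row_free_inj => /(_ 1 (delta_mx 0 i) (delta_mx 0 j)).
rewrite -!rowE !rowK !ffunE eqxx eq_sym (negPf ij) => /(_ e)/rowP/(_ i)/eqP.
by rewrite !mxE !eqxx /= (negPf ij) oner_eq0.
Qed.

Lemma fix_reflection n (S : {set 'I_n}) :
  ('Fix_(char_funs n | relabel_action n)[wreath (S, 1%g)])%g = reflected_char S.
Proof.
have wV : ((wreath (S, 1)%g)^-1 = wreath (S, 1))%g.
  apply/eqP; rewrite eq_invg_mul; apply/eqP/permP => -[i b].
  by rewrite permM [RHS]perm1 !permE /= ?permE -addbA addbb addbF.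
apply/setP => lam; rewrite !inE finset.sub1set inE; apply: andb_id2l => _.
apply/eqP/forall_inP => [/ffunP fx i iS|fx].
  by have := fx (i, false); rewrite ffunE wV permE /= ?permE iS /= => ->.
apply/ffunP => -[i b]; rewrite ffunE wV permE /= ?permE.
have [/fx/eqP e|_] := boolP (i \in S); last by rewrite addbF.
by case: b; rewrite ?e.
Qed.

(** A symmetry that moves some direction takes a facet to a facet that meets it,
and these have different labels. *)
Lemma fix_permutation n (S : {set 'I_n}) (t : {perm 'I_n}) : t != 1%g ->
  ('Fix_(char_funs n | relabel_action n)[wreath (S, t)])%g = finset.set0.
Proof.
move=> t1; apply/setP => lam; rewrite !inE finset.sub1set inE.
apply/negP => /andP[ch /eqP fx]; case/eqP: t1; apply/permP => i.
rewrite perm1; apply/eqP; apply: contraT => ti.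
have : lam (wreath (S, t) (i, false)) != lam (i, false).
  by apply: is_char_neq; rewrite ?permE.
by rewrite -{1}fx ffunE permK eqxx.
Qed.

(** Only the reflections, one for each set S of directions, have fixed points in
the Cauchy-Frobenius formula; the sum over S is sorted by k = n - |S|. *)
Lemma card_char_orbits n :
  (#|orbit (relabel_action n) (cube_aut n) @: char_funs n| * (2 ^ n * n`!) =
   \sum_(0 <= k < n.+1) 'C(n, k) * 2 ^ (k * (n - k)) * num_acyclic_digraphs k
   * #|units_mx n|)%N.
Proof.
rewrite -card_cube_aut -Frobenius_Cauchy; last exact: cube_aut_acts.
transitivity (\sum_(S : {set 'I_n}) #|reflected_char S|)%N.
  rewrite (reindex_onto (fun q => wreath q)
     (fun s => odflt (finset.set0, 1%g) [pick q | wreath q == s])) /=; last first.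
    move=> s /cube_aut_wreath[q ->]; case: pickP => [r /eqP //|/(_ q)].
    by rewrite eqxx.
  rewrite (eq_bigl xpredT); last first.
    move=> q; rewrite wreath_aut; case: pickP => [r /eqP/wreath_inj->|/(_ q)] /=.
      by rewrite eqxx.
    by rewrite eqxx.
  rewrite (eq_bigr (fun q =>
    #|('Fix_(char_funs n | relabel_action n)[wreath (q.1, q.2)])%g|)); last by case.
  rewrite -(pair_bigA _
    (fun S t => #|('Fix_(char_funs n | relabel_action n)[wreath (S, t)])%g|)) /=.
  apply: eq_bigr => S _; rewrite (bigD1 1%g) //= fix_reflection big1 ?addn0 // => t t1.
  by rewrite fix_permutation // cards0.
rewrite (reindex_inj (inv_inj (@finset.setCK _))) /=.
rewrite (partition_big (fun S : {set 'I_n} => inord #|S| : 'I_n.+1) xpredT) //= big_mkord.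
have cS (S : {set 'I_n}) : (#|S| < n.+1)%N.
  by rewrite ltnS -[n in (_ <= n)%N]card_ord max_card.
apply: eq_bigr => k _.
rewrite (eq_bigr (fun=> (#|units_mx n| * (2 ^ (k * (n - k)) * num_acyclic_digraphs k))%N)).
  have ck : #|[set S : {set 'I_n} | inord #|S| == k]%SET| = 'C(n, k).
    rewrite -[n in 'C(n, _)]card_ord -card_draws.
    by apply: eq_card => S; rewrite !inE -val_eqE /= inordK.
  rewrite sum_nat_cond_const ck.
  by rewrite -!mulnA; congr (_ * _)%N; rewrite mulnC -!mulnA.
move=> S /eqP <-; rewrite card_reflected_char finset.setCK inordK //.
by have /(canRL (addKn _)) := cardsC S; rewrite card_ord => ->.
Qed.

Lemma num_char_orbits n : (0 < n)%N ->
  (#|orbit (relabel_action n) (cube_aut n) @: char_funs n|)%:R =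
    (\sum_(0 <= k < n.+1)
       'C(n, k)%:R * 2 ^+ (k * (n - k)) * (num_acyclic_digraphs k)%:R)
    / (2 ^+ n * n`!%:R)
    * \prod_(0 <= i < n) (2 ^+ n - 2 ^+ i) :> rat.
Proof.
move=> n0; have := congr1 (fun m => m%:R : rat) (card_char_orbits n).
rewrite -big_distrl /= !natrM card_units_mx // => e.
have d0 : 2 ^+ n * n`!%:R != 0 :> rat.
  by rewrite mulf_neq0 ?expf_neq0 ?pnatr_eq0 // -lt0n fact_gt0.
rewrite -natrX mulrAC; apply: (canRL (mulfK _)); rewrite natrX // -natrX e.
congr (_ * _); first by rewrite natr_sum; apply: eq_bigr => k _; rewrite !natrM natrX.
rewrite natr_prod big_nat [RHS]big_nat; apply: eq_bigr => i /andP[_ lin].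
by rewrite natrB ?natrX // leq_exp2l // ltnW.
Qed.

(** * Row vectors, convexity and the faces of the cube *)

Import numFieldNormedType.Exports.
Local Open Scope classical_set_scope.
Local Open Scope ring_scope.

Section Near.
Variables (T : topologicalType) (x : T).

Lemma near_mono (P Q : T -> Prop) :
  (forall z, P z -> Q z) -> (\forall z \near x, P z) -> \forall z \near x, Q z.
Proof. by move=> PQ; apply: filterS. Qed.

Lemma near_always (P : T -> Prop) : (forall z, P z) -> \forall z \near x, P z.
Proof. by move=> nP; apply: nearW. Qed.

Lemma near_and (P Q : T -> Prop) : (\forall z \near x, P z) ->
  (\forall z \near x, Q z) -> \forall z \near x, P z /\ Q z.
Proof. by move=> nP nQ; apply: filterI. Qed.

Lemma near_all (I : finType) (P : I -> T -> Prop) :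
  (forall i, \forall z \near x, P i z) -> \forall z \near x, forall i, P i z.
Proof. exact: filter_forall. Qed.

Lemma near_open (U : set T) : open U -> U x -> \forall z \near x, U z.
Proof. by move=> oU Ux; apply: open_nbhs_nbhs. Qed.

Lemma near_comp (S : topologicalType) (f : T -> S) (P : S -> Prop) :
  {for x, continuous f} -> (\forall z \near f x, P z) -> \forall z \near x, P (f z).
Proof. by move=> cf nP; exact: cf nP. Qed.
End Near.

Section Rows.
Variable R : realType.

Lemma cvg_row (T : Type) (F : set_system T) (FF : Filter F) n
    (f : T -> 'rV[R]_n) (l : 'rV[R]_n) :
  (forall i, f x 0 i @[x --> F] --> l 0 i) -> f @ F --> l.
Proof.
move=> cf A [P lP PA]; rewrite nbhs_simpl.
have : \forall x \near F, forall i, P 0 i (f x 0 i).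
  by apply: filter_forall => i; apply: cf; exact: lP.
by apply: filterS => x Px; apply: PA => i j; rewrite ord1.
Qed.

Lemma continuous_row (T : topologicalType) n (f : T -> 'rV[R]_n) x :
  (forall i, {for x, continuous (fun y => f y 0 i)}) -> {for x, continuous f}.
Proof. by move=> cf; apply: cvg_row => i; exact: cf. Qed.

Lemma continuous_coord n (i : 'I_n) : continuous (fun y : 'rV[R]_n => y 0 i).
Proof. exact: coord_continuous. Qed.

Lemma hausdorff_row n : hausdorff_space 'rV[R]_n.
Proof. exact: norm_hausdorff. Qed.

Lemma near_coord_neq n (y : 'rV[R]_n) i (b : R) :
  y 0 i != b -> \forall z \near y, (z : 'rV[R]_n) 0 i != b.
Proof.
move=> yb; have : open [set u : R | u != b] by exact: open_neq.
move/(@open_comp _ _ (fun y : 'rV[R]_n => y 0 i)) => op.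
have : open_nbhs y [set z : 'rV[R]_n | z 0 i != b].
  by split=> //; apply: op => z _; exact: continuous_coord.
exact: open_nbhs_nbhs.
Qed.

Definition segment n (x y : 'rV[R]_n) (t : R) : 'rV[R]_n := x + t *: (y - x).

Definition convex n (S : set 'rV[R]_n) :=
  forall x y t, S x -> S y -> 0 <= t <= 1 -> S (segment x y t).

Lemma segmentE n (x y : 'rV[R]_n) t i :
  segment x y t 0 i = x 0 i + t * (y 0 i - x 0 i).
Proof. by rewrite !mxE. Qed.

Lemma segment_start n (x y : 'rV[R]_n) : segment x y 0 = x.
Proof. by rewrite /segment scale0r addr0. Qed.

Lemma segment_end n (x y : 'rV[R]_n) : segment x y 1 = y.
Proof. by rewrite /segment scale1r addrC subrK. Qed.

Lemma continuous_segment n (x y : 'rV[R]_n) : continuous (segment x y).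
Proof.
move=> t; apply: continuous_row => i.
rewrite (_ : (fun _ => _) = fun t => x 0 i + t * (y 0 i - x 0 i)); last first.
  by apply/funext => s; rewrite segmentE.
by apply: cvgD; [exact: cvg_cst | apply: cvgM; [exact: cvg_id | exact: cvg_cst]].
Qed.

(** Along the segment from x to y the truth value of Q is locally constant, and an
interval is connected. *)
Lemma convex_locally_constant n (S : set 'rV[R]_n) (Q : 'rV[R]_n -> Prop) :
  convex S ->
  (forall x, S x -> \forall y \near x, S y -> (Q y <-> Q x)) ->
  forall x y, S x -> S y -> Q x -> Q y.
Proof.
move=> cS lQ x y Sx Sy Qx.
pose g := segment x y.
have Sg (t : R) : 0 <= t <= 1 -> S (g t) by exact: cS.
have lg (t : R) : 0 <= t <= 1 -> \forall u \near t, 0 <= u <= 1 -> (Q (g u) <-> Q (g t)).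
  move=> t01.
  have : \forall u \near t, S (g u) -> (Q (g u) <-> Q (g t)).
    exact: (@continuous_segment _ x y t _ (lQ _ (Sg _ t01))).
  by apply: filterS => u H u01; apply: H; exact: Sg.
pose B := [set t : R | 0 <= t <= 1 /\ Q (g t)].
have : B = `[0, 1]%classic.
  apply: (segment_connected (a := 0) (b := 1)).
  - by exists 0; split; [rewrite lexx ler01 | rewrite /g segment_start].
  - exists ([set t : R | 0 <= t <= 1 -> Q (g t)]°); first exact: open_interior.
    apply/seteqP; split=> [t [t01 Qt]|t [/=]].
      split; first by rewrite /= in_itv.
      have := lg _ t01; apply: filterS => u H u01.
      exact/(H u01).
    by rewrite in_itv /= => t01 /interior_subset /= H; split=> //; exact: H.
  - exists (~` [set t : R | 0 <= t <= 1 -> ~ Q (g t)]°).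
      exact/open_closedC/open_interior.
    apply/seteqP; split=> [t [t01 Qt]|t [/=]].
      split; first by rewrite /= in_itv.
      by move=> /interior_subset /= H; exact: H.
    rewrite in_itv /= => t01 nQ; split=> //; apply: contrapT => nQt; apply: nQ.
    by have := lg _ t01; apply: filterS => u H u01 /(H u01).
move/seteqP => [_ /(_ 1)]; rewrite /= in_itv /= ler01 lexx => /(_ isT)[_].
by rewrite /g segment_end.
Qed.

End Rows.

(** Coordinatewise, this keeps a segment that starts in the interior of the cube
inside the interior until its end point. *)
Lemma interior_segment (R : realType) (a b t : R) :
  0 < a < 1 -> 0 <= b <= 1 -> 0 <= t < 1 -> 0 < a + t * (b - a) < 1.
Proof.
move=> /andP[a0 a1] /andP[b0 b1] /andP[t0 t1].
have h1 : 0 < (1 - t) * a by rewrite mulr_gt0 ?subr_gt0.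
have h2 : 0 <= t * b by rewrite mulr_ge0.
have h3 : 0 < (1 - t) * (1 - a) by rewrite mulr_gt0 ?subr_gt0.
have h4 : 0 <= t * (1 - b) by rewrite mulr_ge0 ?subr_ge0.
by apply/andP; split; lra.
Qed.

Section Cube.
Variables (R : realType) (n : nat).
Implicit Types (y : 'rV[R]_n) (F : facet n).

Definition facets_at y : {set facet n} := [set F : facet n | y 0 F.1 == F.2%:R]%SET.

Lemma cube_codimE y : cube_codim y = #|facets_at y|.
Proof.
rewrite -(@card_in_imset _ _ (@fst 'I_n bool)); last first.
  move=> [i b] [j c]; rewrite !inE /= => /eqP yb /eqP yc ij; subst j.
  congr pair; move: yb; rewrite yc; case: b c {yc} => [] [] // /eqP.
    by rewrite eq_sym oner_eq0.
  by rewrite oner_eq0.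
apply: eq_card => i; rewrite !inE; apply/idP/imsetP => [|[[j b]]].
  by case/orP => yi; [exists (i, false) | exists (i, true)]; rewrite ?inE.
by rewrite inE /= => /eqP yb ->; rewrite yb; case: b {yb}; rewrite eqxx ?orbT.
Qed.

(** A facet that does not contain y stays away from a neighborhood of y. *)
Lemma near_facets_at y : \forall z \near y, facets_at z \subset facets_at y.
Proof.
suff : \forall z \near y, forall F : facet n, F \notin facets_at y -> F \notin facets_at z.
  by apply: near_mono => z H; apply/fintype.subsetP => F; apply: contraLR; exact: H.
apply: near_all => -[i b]; rewrite inE /=.
have [_|yb] := eqVneq (y 0 i) b%:R; first exact: near_always.
by have := near_coord_neq yb; apply: near_mono => z zb _; rewrite inE.
Qed.

Lemma compact_cube : compact (cube (R := R) (n := n)).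
Proof.
rewrite (_ : @cube R n = [set x | forall i, `[0, 1]%classic (x 0 i)]).
  have := @rV_compact R n (fun=> `[0, 1]%classic).
  by apply=> i; exact: segment_compact.
by apply/seteqP; split=> x H i; have := H i; rewrite /= in_itv.
Qed.

(** The relative interior of the facet F. *)
Definition open_facet F y := cube y /\ facets_at y = [set F]%SET.

Lemma open_facetP F y : open_facet F y <->
  y 0 F.1 = F.2%:R /\ forall i, i != F.1 -> 0 < y 0 i < 1.
Proof.
split=> [[cy /setP fy]|[yF yi]].
  have : F \in facets_at y by rewrite fy inE.
  rewrite inE => /eqP yF; split=> // i iF.
  have := cy i; have := fy (i, false); have := fy (i, true).
  rewrite !inE /=; case: F iF {fy yF} => j b /= ij.
  rewrite !xpair_eqE (negPf ij) /= => y1 y0.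
  by rewrite !le_eqVlt eq_sym y0 y1.
split.
  move=> i; have [->|/yi/andP[/ltW-> /ltW->]//] := eqVneq i F.1.
  by rewrite yF; case: F.2; rewrite ?lexx ?ler01.
apply/setP => -[i b]; rewrite !inE /=; case: F yF yi => j c /= yF yi.
have [->|ij] := eqVneq i j.
  by rewrite yF xpair_eqE eqxx /=; case: b c {yF} => [] [];
    rewrite ?eqxx // ?oner_eq0 // eq_sym oner_eq0.
rewrite xpair_eqE (negPf ij) /=; have /andP[y0 y1] := yi _ ij.
by case: b; [rewrite lt_eqF | rewrite gt_eqF].
Qed.

Lemma convex_open_facet F : convex (open_facet F).
Proof.
move=> x y t /open_facetP[xF xi] /open_facetP[yF yi] t01; apply/open_facetP.
split=> [|i iF]; rewrite segmentE; first by rewrite xF yF subrr mulr0 addr0.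
move: t01; rewrite [t <= 1]le_eqVlt => /andP[t0 /orP[/eqP->|t1]].
  by rewrite mul1r addrC subrK yi.
apply: interior_segment; rewrite ?t0 ?xi //.
by have /andP[/ltW-> /ltW->] := yi _ iF.
Qed.

Definition facet_center F : 'rV[R]_n :=
  \row_i (if i == F.1 then F.2%:R else 2^-1).

Lemma facet_centerP F : open_facet F (facet_center F).
Proof.
apply/open_facetP; rewrite mxE eqxx; split=> // i iF.
by rewrite mxE (negPf iF) invr_gt0 invf_lt1 ?ltr0n ?ltr1n.
Qed.

Definition vertex (v : {ffun 'I_n -> bool}) : 'rV[R]_n := \row_i (v i)%:R.

Lemma cube_vertex v : cube (vertex v).
Proof. by move=> i; rewrite mxE; case: (v i); rewrite ?lexx ?ler01. Qed.

Lemma facets_at_vertex v F : (F \in facets_at (vertex v)) = (F.2 == v F.1).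
Proof.
case: F => i b; rewrite inE mxE /=.
by case: b (v i) => [] []; rewrite ?eqxx // ?oner_eq0 // eq_sym oner_eq0.
Qed.

Lemma codim_vertex v : cube_codim (vertex v) = n.
Proof.
rewrite /cube_codim (_ : [set _ | _]%SET = [set: 'I_n]%SET) ?cardsT ?card_ord //.
by apply/setP => i; rewrite !inE mxE; case: (v i); rewrite eqxx ?orbT.
Qed.

End Cube.

(** * Isotropy groups of a locally standard action *)

Section StandardChart.
Variables (R : realType) (n : nat).
Implicit Types (z : 'rV[R]_n) (t u : 'rV['F_2]_n).

Lemma F2rowDD t : t + t = 0.
Proof. by apply/rowP => i; rewrite !mxE F2_addxx. Qed.

Definition indicator_row (S : {set 'I_n}) : 'rV['F_2]_n := \row_i (i \in S)%:R.

Definition zeros z := [set i | z 0 i == 0]%SET.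
Definition F2support t := [set i | t 0 i != 0]%SET.

Lemma F2supportK : cancel F2support indicator_row.
Proof.
move=> t; apply/rowP => i; rewrite mxE inE.
by case: (eqVneq (t 0 i) 0) => [-> //|]; rewrite F2_neq0 => /eqP->.
Qed.

Lemma indicator_rowK : cancel indicator_row F2support.
Proof. by move=> S; apply/setP => i; rewrite inE mxE; case: (i \in S). Qed.

Lemma standard_act_fix t z : standard_act t z = z <-> F2support t \subset zeros z.
Proof.
split=> [/rowP tz|/fintype.subsetP tz].
  apply/fintype.subsetP => i; rewrite !inE => ti; have := tz i.
  rewrite mxE (negPf ti) => /eqP; rewrite eq_sym -subr_eq0 opprK -mulr2n.
  by rewrite mulrn_eq0.
apply/rowP => i; rewrite mxE; case: eqP => // /eqP ti.
have := tz i; rewrite !inE => /(_ ti)/eqP->; exact: oppr0.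
Qed.

End StandardChart.

Section Action.
Variables (n : nat) (M : topologicalType) (a : Z2_action n M).

Lemma act_inv t : involutive (a t).
Proof. by move=> x; rewrite -actD F2rowDD act0. Qed.

Lemma act_comm s t x : a s (a t x) = a t (a s x).
Proof. by rewrite -!actD addrC. Qed.

Lemma act_sum_fix (I : finType) (S : {set I}) (f : I -> 'rV['F_2]_n) x :
  (forall i, i \in S -> a (f i) x = x) -> a (\sum_(i in S) f i) x = x.
Proof.
move=> fx; elim/big_rec: _ => [|i t iS IH]; first exact: act0.
by rewrite actD IH fx.
Qed.

Lemma open_act t (U : set M) : open U -> open (a t @^-1` U).
Proof. by move/(open_comp (f := a t)); apply=> x _; exact: act_continuous. Qed.

End Action.

Section EquivariantChart.
Variables (R : realType) (n : nat) (M : topologicalType) (a : Z2_action n M).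
Variables (c : chart R n M) (alpha : {additive 'rV['F_2]_n -> 'rV['F_2]_n}).
Hypothesis c_equi : forall t x, chart_dom c x ->
  chart_dom c (a t x) /\ chart_map c (a t x) = standard_act (alpha t) (chart_map c x).

Lemma chart_map_inj x y : chart_dom c x -> chart_dom c y ->
  chart_map c x = chart_map c y -> x = y.
Proof. by move=> cx cy e; rewrite -(chart_mapK cx) e chart_mapK. Qed.

(** The standard action negates coordinates, and only 0 is its own negative. *)
Lemma chart_stab t x : chart_dom c x ->
  a t x = x <-> F2support (alpha t) \subset zeros (chart_map c x).
Proof.
move=> cx; have [ctx mtx] := c_equi t cx; rewrite -standard_act_fix -mtx.
by split=> [-> //|]; apply: chart_map_inj.
Qed.

Lemma near_chart_dom x : chart_dom c x -> \forall y \near x, chart_dom c y.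
Proof. by move=> cx; apply: near_open => //; exact: chart_dom_open. Qed.

(** Nonzero coordinates stay nonzero nearby. *)
Lemma near_chart_zeros x : chart_dom c x ->
  \forall y \near x, zeros (chart_map c y) \subset zeros (chart_map c x).
Proof.
move=> cx.
suff : \forall y \near x, forall i, i \notin zeros (chart_map c x) ->
    i \notin zeros (chart_map c y).
  by apply: near_mono => z H; apply/fintype.subsetP => i; apply: contraLR; exact: H.
apply: near_all => i; rewrite inE.
have [_|xi] := eqVneq (chart_map c x 0 i) 0; first exact: near_always.
have := near_comp (chart_map_cont cx) (near_coord_neq xi).
by apply: near_mono => y yi _; rewrite inE.
Qed.

(** The isotropy group determines the codimension; in particular it is the same
in all standard charts around a point. *)
Lemma card_stab x : chart_dom c x -> bijective alpha ->
  #|[set t | `[< a t x = x >]]%SET| = (2 ^ orthant_codim (chart_map c x))%N.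
Proof.
move=> cx bij.
rewrite -[orthant_codim _]/#|zeros (chart_map c x)| -card_powerset.
have inj : injective (@F2support n \o alpha).
  by apply: inj_comp; [exact: can_inj (@F2supportK n) | exact: bij_inj].
rewrite -(card_imset _ inj); apply: eq_card => S; rewrite inE.
apply/imsetP/idP => [[t]|Sz].
  by rewrite inE => /asboolP/(chart_stab _ cx) ? ->.
have [beta _ betaK] := bij; exists (beta (indicator_row S)).
  rewrite inE; apply/asboolP/(chart_stab _ cx); rewrite betaK.
  by rewrite indicator_rowK.
by rewrite /= betaK indicator_rowK.
Qed.

End EquivariantChart.

Section OrbitMap.
Variables (R : realType) (n : nat) (M : smooth_manifold R n) (a : Z2_action n M).
Variable p : M -> 'rV[R]_n.
Hypotheses (a_std : locally_standard a) (pP : orbit_map_onto_cube a p).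

Lemma orbit_continuous : continuous p. Proof. by case: pP. Qed.

Lemma orbit_cube x : cube (p x).
Proof. by case: pP => _ <- _ _ _; exists x. Qed.

Lemma orbit_surj y : cube y -> exists x, p x = y.
Proof. by case: pP => _ <- _ _ _ [x _ <-]; exists x. Qed.

Lemma orbit_mapP x y : p x = p y <-> exists t, a t x = y.
Proof. by case: pP. Qed.

Lemma orbit_act t x : p (a t x) = p x.
Proof. by apply/esym/orbit_mapP; exists t. Qed.

(** The map p is open onto the cube: the saturation of an open set is a union of
translates, hence open, and p is a quotient map. *)
Lemma orbit_open (P : M -> Prop) x : (\forall x' \near x, P x') ->
  \forall y \near p x, cube y -> exists2 x', p x' = y & P x'.
Proof.
move=> nP; have : nbhs x P by []; rewrite nbhsE => -[U [oU Ux] UP].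
have oV : open (p @^-1` (p @` U)).
  rewrite (_ : _ @^-1` _ = \bigcup_t (a t @^-1` U)).
    by apply: bigcup_open => t _; exact: open_act.
  apply/seteqP; split=> [x' [u Uu /esym/orbit_mapP[t tx']]|x' [t _ Utx']].
    by exists t => //; rewrite /preimage /= tx'.
  by exists (a t x') => //; exact: orbit_act.
have [_ _ _ /(_ _ oV)[W oW WV] _] := pP.
have Wp : W (p x).
  have : (W `&` cube (R := R) (n := n)) (p x).
    by rewrite WV; split; [exists x | exact: orbit_cube].
  by case.
apply: near_mono (near_open oW Wp) => y Wy cy.
have : ((p @` U) `&` cube (R := R) (n := n)) y by rewrite -WV.
by case=> -[x' Ux' <-] _; exists x' => //; exact: UP.
Qed.

Lemma stab_orbit x y t : p x = p y -> a t x = x <-> a t y = y.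
Proof.
move/orbit_mapP => [s <-]; rewrite act_comm; split=> [-> //|].
exact: (can_inj (act_inv a s)).
Qed.

Lemma standard_codim c x : standard_chart a c -> chart_dom c x ->
  cube_codim (p x) = orthant_codim (chart_map c x).
Proof. by case: pP => _ _ _ _; apply. Qed.

Lemma card_stab_orbit x :
  #|[set t | `[< a t x = x >]]%SET| = (2 ^ cube_codim (p x))%N.
Proof.
have [c sc cx] := a_std x; rewrite (standard_codim sc cx).
by have [_ [alpha [bij equi]]] := sc; rewrite (card_stab equi).
Qed.

(** In a chart around x the points near x have at most the zero coordinates of x,
so those with equally many have the same ones. *)
Lemma stab_locally_constant x t :
  \forall y \near p x, cube y -> cube_codim y = cube_codim (p x) ->
    forall x', p x' = y -> a t x' = x' <-> a t x = x.
Proof.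
have [c sc cx] := a_std x; have [_ [alpha [bij equi]]] := sc.
have := orbit_open (near_and (near_chart_dom cx) (near_chart_zeros cx)).
apply: near_mono => y /[apply] -[x' <- [cx' zx']] e x'' e''.
rewrite (stab_orbit _ e'') (chart_stab equi _ cx') (chart_stab equi _ cx).
suff -> : zeros (chart_map c x') = zeros (chart_map c x) by [].
apply/eqP; rewrite eqEcard zx' /=.
by rewrite -[#|zeros (chart_map c x)|](standard_codim sc cx) -e (standard_codim sc cx').
Qed.

Lemma codim_open_facet F (y : 'rV[R]_n) : open_facet F y -> cube_codim y = 1%N.
Proof. by move=> [_ fy]; rewrite cube_codimE fy cards1. Qed.

(** The isotropy group is locally constant over the relative interior of F, which
is convex. *)
Lemma stab_open_facet F x x' : open_facet F (p x) -> open_facet F (p x') ->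
  forall t, a t x = x -> a t x' = x'.
Proof.
move=> Fx Fx' t tx.
have := @convex_locally_constant R n (open_facet F)
  (fun y => forall x, p x = y -> a t x = x) (@convex_open_facet R n F).
move=> /(_ _ (p x) (p x') Fx Fx'); apply=> // [y Fy|x'' e].
  have [z pz] := orbit_surj Fy.1.
  have := stab_locally_constant z t; rewrite pz; apply: near_mono => y' H Fy'.
  have {}H := H Fy'.1 _; rewrite !(codim_open_facet Fy, codim_open_facet Fy') in H.
  split=> Hy w pw; last by apply/(H _ _ pw) => //; exact: Hy.
  have [z' pz'] := orbit_surj Fy'.1.
  by apply/(stab_orbit t (etrans pw (esym pz))); apply/(H erefl _ pz'); exact: Hy.
exact/(stab_orbit t e).
Qed.

Definition stab_generator (lam : char_fun n) := forall F x,
  open_facet F (p x) -> forall t, a t x = x <-> t = 0 \/ t = lam F.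

Lemma exists_stab_generator : exists lam, stab_generator lam.
Proof.
have gen F : exists g, forall x, open_facet F (p x) ->
    forall t, a t x = x <-> t = 0 \/ t = g.
  have [x0 px0] := orbit_surj (facet_centerP R F).1.
  have F0 : open_facet F (p x0) by rewrite px0; exact: facet_centerP.
  have [c sc cx] := a_std x0; have [_ [alpha [bij equi]]] := sc.
  have /eqP/cards1P[j zj] : #|zeros (chart_map c x0)| = 1%N.
    by rewrite -[LHS](standard_codim sc cx) (codim_open_facet F0).
  have [beta alphaK betaK] := bij; exists (beta (indicator_row [set j]%SET)) => x Fx t.
  have -> : a t x = x <-> a t x0 = x0.
    by split; [exact: (stab_open_facet Fx F0) | exact: (stab_open_facet F0 Fx)].
  rewrite (chart_stab equi _ cx) zj subset1; split.
    case/orP => /eqP st; [right|left]; apply: (can_inj alphaK).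
      by rewrite betaK -st F2supportK.
    by rewrite -[alpha t]F2supportK st raddf0; apply/rowP => i; rewrite !mxE inE.
  case=> ->.
    rewrite raddf0; apply/orP; right; apply/eqP/setP => i.
    by rewrite !inE mxE eqxx.
  by rewrite betaK indicator_rowK eqxx.
have /choice[g gP] := gen.
by exists [ffun F => g F] => F x Fx t; rewrite ffunE; exact: gP.
Qed.

(** Over the field with two elements the subset sums of the labels of the facets
through p x are their span. *)
Definition char_fun_for (lam : char_fun n) :=
  is_char lam /\ forall x t, a t x = x <->
    exists2 S : {set facet n}, S \subset facets_at (p x) & t = \sum_(F in S) lam F.

End OrbitMap.

(** * The characteristic function of a small cover *)

Section CharFun.
Variables (R : realType) (n : nat) (M : smooth_manifold R n) (a : Z2_action n M).
Variable p : M -> 'rV[R]_n.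
Hypotheses (a_std : locally_standard a) (pP : orbit_map_onto_cube a p).
Variable lam : char_fun n.
Hypothesis lamP : stab_generator a p lam.

(** Perturb x in the chart so that only the coordinate j remains zero.  The new
point lies over the relative interior of some facet G, which contains p x since
the perturbation is small, and its isotropy group, generated by the j-th
reflection of the chart, is the one of G. *)
Lemma generator_of_zero c (alpha : {additive 'rV['F_2]_n -> 'rV['F_2]_n}) x j :
  standard_chart a c -> bijective alpha ->
  (forall t x, chart_dom c x ->
    chart_dom c (a t x) /\ chart_map c (a t x) = standard_act (alpha t) (chart_map c x)) ->
  chart_dom c x -> j \in zeros (chart_map c x) ->
  exists2 G, G \in facets_at (p x) & alpha (lam G) = indicator_row [set j]%SET.
Proof.
move=> sc bij equi cx jZ; set z := chart_map c x in jZ.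
(* Move along v, which makes all zero coordinates but the j-th nonzero. *)
pose v : 'rV[R]_n := \row_i ((i \in zeros z) && (i != j))%:R.
pose w (e : R) := segment z (z + v) e.
have w0 : w 0 = z by exact: segment_start.
have wE e i : w e 0 i = z 0 i + e * ((i \in zeros z) && (i != j))%:R.
  by rewrite segmentE !mxE addrAC subrr add0r.
have cz : chart_cod c z by exact: chart_map_cod.
have wcont : continuous w by exact: continuous_segment.
have near_cod : \forall e \near 0, chart_cod c (w e).
  apply: (near_comp (wcont 0)); rewrite w0.
  by apply: near_open cz; exact: chart_cod_open.
have near_fac : \forall e \near 0,
    facets_at (p (chart_inv c (w e))) \subset facets_at (p x).
  have pcont : {for 0, continuous (fun e => p (chart_inv c (w e)))}.
    apply: (@continuous_comp _ _ _ w (p \o chart_inv c)); first exact: wcont.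
    apply: continuous_comp; last exact: (orbit_continuous pP).
    by rewrite w0; exact: chart_inv_cont.
  have -> : p x = p (chart_inv c (w 0)) by rewrite w0 chart_mapK.
  exact: (near_comp pcont (near_facets_at _)).
have [e e0 [we Fe]] : exists2 e : R, e != 0 & chart_cod c (w e) /\
    facets_at (p (chart_inv c (w e))) \subset facets_at (p x).
  have /nbhs_ballP[d /= d0 dP] := near_and near_cod near_fac.
  exists (d / 2); first by rewrite gt_eqF // divr_gt0.
  apply: dP; rewrite /ball /= sub0r normrN gtr0_norm ?divr_gt0 //.
  by rewrite ltr_pdivrMr // ltr_pMr // ltr1n.
set x' := chart_inv c (w e) in Fe.
have cx' : chart_dom c x' by exact: chart_inv_dom.
have zx' : zeros (chart_map c x') = [set j]%SET.
  rewrite chart_invK //; apply/setP => i; rewrite !inE wE inE.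
  have [->|ij] := eqVneq i j.
    by rewrite andbF mulr0 addr0; move: jZ; rewrite inE.
  have [->|zi] := eqVneq (z 0 i) 0; first by rewrite add0r mulr1 (negPf e0).
  by rewrite mulr0 addr0 (negPf zi).
have /eqP/cards1P[G GP] : #|facets_at (p x')| = 1%N.
  rewrite -cube_codimE (standard_codim pP sc cx').
  by rewrite -[LHS]/#|zeros (chart_map c x')| zx' cards1.
have FG : open_facet G (p x') by split; [exact: (orbit_cube pP) | exact: GP].
exists G; first by apply: (fintype.subsetP Fe); rewrite GP inE.
have [beta alphaK betaK] := bij.
have : a (beta (indicator_row [set j]%SET)) x' = x'.
  by apply/(chart_stab equi _ cx'); rewrite betaK indicator_rowK zx'.
case/(lamP FG) => [b0|<-]; last by rewrite betaK.
have := congr1 alpha b0; rewrite betaK raddf0 => /rowP/(_ j)/eqP.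
by rewrite !mxE inE eqxx oner_eq0.
Qed.

(** There are as many facets through p x as coordinates of x that vanish, so that
the injective assignment of facets to zero coordinates is onto. *)
Lemma generators_at x : exists c (alpha : {additive 'rV['F_2]_n -> 'rV['F_2]_n})
  (G : 'I_n -> facet n), [/\ standard_chart a c,
  chart_dom c x,
  (forall t x, chart_dom c x ->
    chart_dom c (a t x) /\ chart_map c (a t x) = standard_act (alpha t) (chart_map c x)),
  bijective alpha &
  [/\ {in zeros (chart_map c x), forall j, alpha (lam (G j)) = indicator_row [set j]%SET},
    {in zeros (chart_map c x) &, injective G} &
    G @: zeros (chart_map c x) = facets_at (p x)]].
Proof.
have [c sc cx] := a_std x; have [_ [alpha [bij equi]]] := sc.
set Z := zeros (chart_map c x).
have /choice[G GP] : forall j, exists G, j \in Z ->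
    G \in facets_at (p x) /\ alpha (lam G) = indicator_row [set j]%SET.
  move=> j; have [jZ|jZ] := boolP (j \in Z); last by exists (j, false).
  by have [G ? ?] := generator_of_zero sc bij equi cx jZ; exists G.
have Ginj : {in Z &, injective G}.
  move=> j k jZ kZ e; have := (GP _ jZ).2; rewrite e (GP _ kZ).2.
  by move/(can_inj (@indicator_rowK n))/set1_inj.
exists c, alpha, G; split=> //; split=> // [j jZ|]; first exact: (GP _ jZ).2.
apply/eqP; rewrite eqEcard; apply/andP; split.
  by apply/fintype.subsetP => _ /imsetP[j jZ ->]; exact: (GP _ jZ).1.
by rewrite card_in_imset // -cube_codimE (standard_codim pP sc cx).
Qed.

Lemma F2row_sum (t : 'rV['F_2]_n) :
  t = \sum_(j in F2support t) indicator_row [set j]%SET.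
Proof.
apply/rowP => i; rewrite summxE.
rewrite (eq_bigr (fun j => (i == j)%:R)); last by move=> j _; rewrite mxE inE.
have [it|it] := boolP (i \in F2support t).
  rewrite (bigD1 i) //= eqxx big1 ?addr0; last first.
    by move=> j /andP[_ /negPf]; rewrite eq_sym => ->.
  by move: it; rewrite inE F2_neq0 => /eqP.
rewrite big1; first by move: it; rewrite inE negbK => /eqP.
by move=> j jt; case: eqVneq it => // ->; rewrite jt.
Qed.

(** In the chart the labels of the facets through p x are the reflections in the
zero coordinates, which generate the isotropy group. *)
Lemma stab_sum_generators x t : a t x = x <->
  exists2 S : {set facet n}, S \subset facets_at (p x) & t = \sum_(F in S) lam F.
Proof.
have [c [alpha [G [sc cx equi bij [GP Ginj GZ]]]]] := generators_at x.
split=> [tx|[S Sx ->]].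
  have tZ : F2support (alpha t) \subset zeros (chart_map c x).
    exact/(chart_stab equi _ cx).
  exists (G @: F2support (alpha t)); first by rewrite -GZ imsetS.
  rewrite big_imset /=; last first.
    by move=> j k /(fintype.subsetP tZ) jZ /(fintype.subsetP tZ) kZ; exact: Ginj.
  apply: (bij_inj bij); rewrite raddf_sum {1}[alpha t]F2row_sum.
  by apply: eq_bigr => j /(fintype.subsetP tZ) jZ; rewrite GP.
apply: act_sum_fix => F /(fintype.subsetP Sx); rewrite -GZ => /imsetP[j jZ ->].
by apply/(chart_stab equi _ cx); rewrite GP // indicator_rowK finset.sub1set.
Qed.

(** Over a vertex the whole group is the isotropy group, so it is spanned by the
n labels. *)
Lemma generators_char : is_char lam.
Proof.
apply/forallP => v; have [x px] := orbit_surj pP (cube_vertex R v).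
have [c [alpha [G [sc cx equi bij [GP Ginj GZ]]]]] := generators_at x.
rewrite -row_full_unit -sub1mx; apply/row_subP => i; rewrite row1.
have /stab_sum_generators[S Sv ->] : a (delta_mx 0 i) x = x.
  apply/(chart_stab equi _ cx).
  suff -> : zeros (chart_map c x) = [set: 'I_n]%SET by exact: finset.subsetT.
  apply/eqP; rewrite eqEcard finset.subsetT cardsT card_ord.
  by apply: eq_leq; rewrite -[LHS](codim_vertex R v) -px; exact: (standard_codim pP sc cx).
apply: summx_sub => -[j b] /(fintype.subsetP Sv); rewrite px facets_at_vertex /=.
by move=> /eqP->; rewrite -[lam _](rowK (fun i => lam (i, v i))) row_sub.
Qed.

Lemma generators_char_fun : char_fun_for a p lam.
Proof. by split; [exact: generators_char | exact: stab_sum_generators]. Qed.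

End CharFun.

Lemma exists_char_fun (R : realType) n (M : smooth_manifold R n) (a : Z2_action n M) p :
  locally_standard a -> orbit_map_onto_cube a p -> exists lam, char_fun_for a p lam.
Proof.
move=> a_std pP; have [lam lamP] := exists_stab_generator a_std pP.
by exists lam; exact: generators_char_fun.
Qed.

(** * Local sections of the orbit map *)

Section Boxes.
Variable R : realType.

Lemma hausdorff_near_neq (T U : topologicalType) (f g : T -> U) x :
  hausdorff_space U -> {for x, continuous f} -> {for x, continuous g} ->
  f x <> g x -> \forall y \near x, f y <> g y.
Proof.
rewrite open_hausdorff => hU cf cg /eqP /hU [[A B] /= [/set_mem Af /set_mem Bg]].
move=> [oA oB /eqP AB].
have := near_and (near_comp cf (near_open oA Af)) (near_comp cg (near_open oB Bg)).
by apply: near_mono => y [Ay By] e; rewrite e in Ay; have : (A `&` B) (g y) by []; rewrite AB.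
Qed.

(** This is how a boundary point of the cube, or of a facet, is approached from the
interior. *)
Lemma near_segment n (x y : 'rV[R]_n) (P : 'rV[R]_n -> Prop) :
  (\forall z \near y, P z) -> exists2 t, 0 <= t < 1 & P (segment x y t).
Proof.
move=> nP.
have : \forall t \near (1 : R), P (segment x y t).
  apply: near_comp; first exact: continuous_segment.
  by rewrite segment_end.
move=> /nbhs_ballP[d /= d0 dP].
set u := Num.max 0 (1 - d / 2).
have d2 : 0 < d / 2 by rewrite divr_gt0.
have u0 : 0 <= u by rewrite le_max lexx.
have u1 : u < 1 by rewrite gt_max ltr01 /= ltrBlDr ltrDl.
have ud : 1 - d / 2 <= u by rewrite le_max lexx orbT.
exists u; first by rewrite u0.
by apply: dP; rewrite /ball /= gtr0_norm ?subr_gt0 //; lra.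
Qed.

Lemma continuous_glue (T U : topologicalType) (f g : T -> U) (h : T -> R) (m : R) :
  continuous f -> continuous g -> continuous h ->
  (forall x, h x = m -> f x = g x) ->
  continuous (fun x => if h x <= m then f x else g x).
Proof.
move=> cf cg ch fg x P /= nP.
have op_lt : open [set u : R | u < m] by exact: open_lt.
have op_gt : open [set u : R | m < u] by exact: open_gt.
move: nP; have [hx|hx|hx] := ltgtP (h x) m => nP.
- have := near_and (near_comp (ch x) (near_open op_lt hx)) (near_comp (cf x) nP).
  by apply: near_mono => y [/= /ltW ->].
- have := near_and (near_comp (ch x) (near_open op_gt hx)) (near_comp (cg x) nP).
  by apply: near_mono => y [/=]; rewrite ltNge => /negPf->.
have nPg : nbhs (g x) P by rewrite -fg.
have := near_and (near_comp (cf x) nP) (near_comp (cg x) nPg).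
by apply: near_mono => y [/= Pf Pg]; case: ifP.
Qed.

Lemma continuous_maxmin (T : topologicalType) (f : T -> R) (b c : R) x :
  {for x, continuous f} -> {for x, continuous (fun y => Num.max b (Num.min c (f y)))}.
Proof.
move=> cf; apply: (@continuous_max R T (fun=> b) (fun y => Num.min c (f y))).
  exact: cvg_cst.
by apply: (@continuous_min R T (fun=> c) f) => //; exact: cvg_cst.
Qed.

Definition box n (a b : 'rV[R]_n) := [set y : 'rV[R]_n | forall i, a 0 i <= y 0 i <= b 0 i].

(** The strict inequality ensures that the box contains points over which the action
is free. *)
Definition proper_box n (a b : 'rV[R]_n) :=
  forall i, [/\ 0 <= a 0 i, a 0 i < b 0 i & b 0 i <= 1].

(** The retraction of the space onto a box, by which maps on the box extend
continuously to the whole space. *)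
Definition clamp n (a b y : 'rV[R]_n) : 'rV[R]_n :=
  \row_i Num.max (a 0 i) (Num.min (b 0 i) (y 0 i)).

Lemma continuous_clamp n (a b : 'rV[R]_n) : continuous (clamp a b).
Proof.
move=> y; apply: continuous_row => i.
rewrite (_ : (fun _ => _) = fun y : 'rV[R]_n => Num.max (a 0 i) (Num.min (b 0 i) (y 0 i))).
  exact/continuous_maxmin/continuous_coord.
by apply/funext => z; rewrite mxE.
Qed.

Lemma clamp_box n (a b y : 'rV[R]_n) :
  (forall i, a 0 i <= b 0 i) -> box a b (clamp a b y).
Proof. by move=> ab i; rewrite mxE le_max lexx ge_max ab ge_min lexx. Qed.

Lemma clamp_id n (a b y : 'rV[R]_n) : box a b y -> clamp a b y = y.
Proof.
by move=> y_ab; apply/rowP => i; rewrite mxE; have /andP[ay yb] := y_ab i;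
  rewrite min_r // max_r.
Qed.

Lemma proper_box_le n (a b : 'rV[R]_n) : proper_box a b -> forall i, a 0 i <= b 0 i.
Proof. by move=> pab i; have [_ /ltW] := pab i. Qed.

Lemma proper_box_cube n (a b : 'rV[R]_n) :
  proper_box a b -> box a b `<=` cube (R := R) (n := n).
Proof.
move=> pab y yab i; have [a0 _ b1] := pab i; have /andP[ay yb] := yab i.
by rewrite (le_trans a0 ay) (le_trans yb b1).
Qed.

Definition set_coord n (a : 'rV[R]_n) (i : 'I_n) (m : R) : 'rV[R]_n :=
  \row_j (if j == i then m else a 0 j).

Lemma set_coordE n (a : 'rV[R]_n) i m j :
  set_coord a i m 0 j = if j == i then m else a 0 j.
Proof. by rewrite mxE. Qed.

End Boxes.

Section LocalSection.
Variables (R : realType) (n : nat) (M : smooth_manifold R n) (a : Z2_action n M).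
Variable p : M -> 'rV[R]_n.
Hypotheses (a_std : locally_standard a) (pP : orbit_map_onto_cube a p).

(** Every orbit that meets a standard chart has a unique point there with
nonnegative coordinates, which depends continuously on the orbit because taking
absolute values of the coordinates is a continuous map of the chart to itself.
The last clause is the continuity of s on the part of the cube in W. *)
Lemma local_section x : exists W (s : 'rV[R]_n -> M), [/\ open W, W (p x),
  forall y, W y -> cube y -> p (s y) = y &
  forall y, W y -> cube y -> forall P : M -> Prop, (\forall z \near s y, P z) ->
    \forall y' \near y, W y' -> cube y' -> P (s y')].
Proof.
have [c sc cx] := a_std x; have [_ [alpha [[beta alphaK betaK] equi]]] := sc.
pose absrow (z : 'rV[R]_n) : 'rV[R]_n := \row_i `|z 0 i|.
pose fold x' := chart_inv c (absrow (chart_map c x')).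
have foldE x' : chart_dom c x' -> exists2 t, fold x' = a t x' &
    chart_map c (a t x') = absrow (chart_map c x').
  move=> cx'; set z := chart_map c x'.
  exists (beta (indicator_row [set i | z 0 i < 0]%SET)).
    have [ct mt] := equi (beta (indicator_row [set i | z 0 i < 0]%SET)) _ cx'.
    rewrite -[RHS](chart_mapK ct) mt betaK; congr chart_inv.
    apply/rowP => i; rewrite !mxE inE -/z.
    by case: ltP => [/ltr0_norm|/ger0_norm] ->.
  have [_ ->] := equi (beta (indicator_row [set i | z 0 i < 0]%SET)) _ cx'.
  rewrite betaK; apply/rowP => i; rewrite !mxE inE -/z.
  by case: ltP => [/ltr0_norm|/ger0_norm] ->.
have fold_orbit x1 x2 : chart_dom c x1 -> p x1 = p x2 -> fold x1 = fold x2.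
  move=> c1 /(orbit_mapP pP)[t <-]; have [_ mt] := equi t _ c1.
  congr chart_inv; rewrite mt; apply/rowP => i; rewrite !mxE.
  by case: ifP; rewrite ?normrN.
have fold_cont x' : chart_dom c x' -> {for x', continuous fold}.
  move=> cx'; have [t ft mt] := foldE _ cx'.
  have [ct _] := equi t _ cx'.
  apply: (@continuous_comp _ _ _ (absrow \o chart_map c) (chart_inv c)).
    apply: continuous_comp; first exact: chart_map_cont.
    apply: continuous_row => i.
    rewrite (_ : (fun _ => _) = fun y : 'rV[R]_n => `|y 0 i|); last first.
      by apply/funext => z; rewrite mxE.
    apply: (@continuous_comp _ _ _ (fun y : 'rV[R]_n => y 0 i) Num.norm).
      exact: continuous_coord.
    exact: norm_continuous.
  by rewrite /= -mt; apply: chart_inv_cont; exact: chart_map_cod.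
have := orbit_open pP (near_chart_dom cx).
move=> nW; have : nbhs (p x) (fun y => cube y -> exists2 x', p x' = y & chart_dom c x') by [].
rewrite nbhsE => -[W [oW Wx] Wlift].
have /choice[l lP] : forall y, exists x', W y -> cube y -> p x' = y /\ chart_dom c x'.
  move=> y; have [[Wy cy]|nWc] := pselect (W y /\ cube y).
    by have [x' ? ?] := Wlift _ Wy cy; exists x'.
  by exists x => Wy cy; case: nWc.
exists W, (fold \o l); split=> // [y Wy cy|y Wy cy P nP] /=.
  have [py cl] := lP _ Wy cy; have [t -> _] := foldE _ cl.
  by rewrite (orbit_act pP).
have [ly cl] := lP _ Wy cy.
have := orbit_open pP (near_and (near_comp (fold_cont _ cl) nP) (near_chart_dom cl)).
rewrite ly; apply: near_mono => y' H Wy' cy'.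
have [x' px' [Px' cx']] := H cy'.
rewrite (_ : fold (l y') = fold x') //; apply/esym/fold_orbit => //.
by rewrite px' (lP _ Wy' cy').1.
Qed.

End LocalSection.

(** * The global section of the orbit map *)

Section GlobalSection.
Variables (R : realType) (n : nat) (M : smooth_manifold R n) (a : Z2_action n M).
Variable p : M -> 'rV[R]_n.
Hypotheses (a_std : locally_standard a) (pP : orbit_map_onto_cube a p).

Definition section_over (l u : 'rV[R]_n) :=
  exists2 s : 'rV[R]_n -> M, continuous s & forall y, box l u y -> p (s y) = y.

(** Around each point of the cube a local section exists; compactness gives a
uniform size. *)
Lemma small_boxes_have_sections : exists2 d : R, 0 < d &
  forall l u, proper_box l u -> (forall i, u 0 i <= l 0 i + d) -> section_over l u.
Proof.
pose P (d : R) (l : 'rV[R]_n) := forall u, proper_box l u ->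
  (forall i, u 0 i <= l 0 i + d) -> section_over l u.
have : \forall d \near (0 : R), cube (R := R) (n := n) `<=` P d.
  have /compact_near_coveringP cov := @compact_cube R n.
  apply: (cov R (nbhs (0 : R)) P (nbhs_filter _)) => y cy.
  have [x px] := orbit_surj pP cy.
  have [W [s [oW Wx ps cs]]] := local_section a_std pP x; rewrite px in Wx.
  have /nbhs_ballP[r /= r0 rW] := near_open oW Wx.
  exists (ball y (r / 2), ball (0 : R) (r / 2)); first split => /=.
  - by apply/nbhs_ballP; exists (r / 2) => //=; rewrite divr_gt0.
  - by apply/nbhs_ballP; exists (r / 2) => //=; rewrite divr_gt0.
  move=> [l d] /= [[_ yl]]; rewrite /ball /= sub0r normrN => dr u plu ud.
  have lu := proper_box_le plu.
  have boxW z : box l u z -> W z.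
    move=> lz; apply: rW; split=> // i j; rewrite ord1 /ball /=.
    have := yl 0 j; rewrite /ball /=; have := lz j; have := ud j; move: dr.
    rewrite !ltr_norml; lra.
  exists (s \o clamp l u); last first.
    move=> z lz; rewrite /= clamp_id // ps //; first exact: boxW.
    exact: proper_box_cube plu _ lz.
  move=> z Q /= nQ.
  have bz : box l u (clamp l u z) by exact: clamp_box.
  have := cs _ (boxW _ bz) (proper_box_cube plu bz) _ nQ.
  move=> /(near_comp (@continuous_clamp R n l u z)); apply: near_mono => w H.
  have bw : box l u (clamp l u w) by exact: clamp_box.
  by apply: H; [exact: boxW | exact: proper_box_cube plu _ bw].
move=> /nbhs_ballP[r /= r0 rP]; exists (r / 2); first by rewrite divr_gt0.
move=> l u plu; apply: (rP (r / 2)) => //; last first.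
  move=> i; have [l0 lu u1] := plu i; rewrite l0 (le_trans (ltW lu)) //.
rewrite /ball /= sub0r normrN gtr0_norm ?divr_gt0 //.
by rewrite ltr_pdivrMr // ltr_pMr // ltr1n.
Qed.

(** The isotropy group has order 2^0. *)
Lemma free_orbit x s t : cube_codim (p x) = 0%N -> a s x = a t x -> s = t.
Proof.
move=> c0 est; have := card_stab_orbit a_std pP x.
rewrite c0 => /eqP/cards1P[w ws].
have : s + t \in [set w]%SET.
  by rewrite -ws inE; apply/asboolP; rewrite actD -est; exact: act_inv.
have : 0 \in [set w]%SET by rewrite -ws inE; apply/asboolP; exact: act0.
rewrite !inE => /eqP<- /eqP st.
by rewrite -[s]addr0 -(F2rowDD t) addrA st add0r.
Qed.

(** Over the interior of the cube the two sections differ by a unique group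
element.  It is locally constant there: in a Hausdorff space each of the
finitely many conditions s1 y <> a t (s2 y) is open.  Since the interior points
of B form a convex set which is dense in B, one element works everywhere. *)
Lemma sections_agree (s1 s2 : 'rV[R]_n -> M) (B : set 'rV[R]_n) c :
  continuous s1 -> continuous s2 -> convex B -> B `<=` cube (R := R) (n := n) ->
  (forall y, B y -> p (s1 y) = y) -> (forall y, B y -> p (s2 y) = y) ->
  B c -> (forall i, 0 < c 0 i < 1) ->
  exists t, forall y, B y -> s1 y = a t (s2 y).
Proof.
move=> cs1 cs2 cB Bcube p1 p2 Bc c01.
have cas2 t : continuous (fun y => a t (s2 y)).
  move=> y; apply: (@continuous_comp _ _ _ s2 (a t)); first exact: cs2.
  exact: act_continuous.
pose T := B `&` [set y | forall i, 0 < y 0 i < 1].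
have lift y : B y -> exists t, s1 y = a t (s2 y).
  by move=> By; have [|t <-] := (orbit_mapP pP (s2 y) (s1 y)).1; [rewrite p1 ?p2 | exists t].
have [t0 ct0] := lift _ Bc; exists t0.
have cT : convex T.
  move=> x y t [Bx x01] [By y01] t01; split; first exact: cB.
  move=> i; rewrite segmentE; move: t01; rewrite [t <= 1]le_eqVlt.
  case/andP => tge /orP[/eqP->|tlt]; first by rewrite mul1r addrC subrK y01.
  by apply: interior_segment; rewrite ?x01 ?tge //; have /andP[/ltW-> /ltW->] := y01 i.
have codim0 y : T y -> cube_codim y = 0%N.
  move=> [_ y01]; apply/eqP; rewrite cards_eq0; apply/eqP/setP => i; rewrite !inE.
  by have /andP[y0 y1] := y01 i; rewrite gt_eqF // lt_eqF.
(* First the points of B in the interior of the cube. *)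
have Q y : T y -> s1 y = a t0 (s2 y).
  move=> Ty.
  apply: (@convex_locally_constant R n T (fun y => s1 y = a t0 (s2 y)) cT _ c y) => //.
  move=> {Ty}y Ty; have [t ty] := lift _ Ty.1.
  have : \forall z \near y, forall t', t' != t -> s1 z <> a t' (s2 z).
    apply: near_all => t'; have [_|tt'] := eqVneq t' t; first exact: near_always.
    have := @hausdorff_near_neq _ _ s1 (fun z => a t' (s2 z)) y
      (@mfd_hausdorff _ _ M) (cs1 y) (@cas2 t' y).
    move=> nn; apply: near_mono (nn _) => [z zn _ //|].
    rewrite ty => e; case/eqP: tt'; apply/esym/(@free_orbit (s2 y)) => //.
    by rewrite p2 ?codim0 //; case: Ty.
  apply: near_mono => z zn Tz; have [t' tz] := lift _ Tz.1.
  have tt' : t' = t by apply: contrapT => /eqP/zn.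
  have ft w : T w -> s1 w = a t (s2 w) -> s1 w = a t0 (s2 w) <-> t0 = t.
    move=> Tw tw; split=> [t0w|-> //].
    by apply/(@free_orbit (s2 w)); rewrite ?p2 ?codim0 -?tw -?t0w //; case: Tw.
  by rewrite tt' in tz; rewrite (ft _ Tz tz) (ft _ Ty ty).
move=> y By; apply: contrapT => nQ.
have /near_segment : \forall z \near y, s1 z <> a t0 (s2 z).
  exact: (hausdorff_near_neq (@mfd_hausdorff _ _ M) (cs1 y) (@cas2 t0 y)).
move=> /(_ c)[t /andP[t0' t1]]; apply; apply: Q; split.
  by apply: cB => //; rewrite t0' ltW.
by move=> i; rewrite segmentE; apply: interior_segment; rewrite ?t0' //; exact: Bcube.
Qed.

(** Correct the section over one half so that it agrees with the other on the
common wall, where the i-th coordinate is m.  Clamping to the two halves agrees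
on the hyperplane through the wall, so the result is continuous on the whole
space. *)
Lemma glue_sections l u i (m : R) : proper_box l u -> l 0 i < m -> m < u 0 i ->
  section_over l (set_coord u i m) -> section_over (set_coord l i m) u ->
  section_over l u.
Proof.
move=> plu lm mu [s1 cs1 p1] [s2 cs2 p2].
set u' := set_coord u i m in p1; set l' := set_coord l i m in p2.
have lu' j : l 0 j <= u' 0 j.
  by rewrite set_coordE; case: eqP => [->|_]; [exact: ltW | exact: proper_box_le].
have l'u j : l' 0 j <= u 0 j.
  by rewrite set_coordE; case: eqP => [->|_]; [exact: ltW | exact: proper_box_le].
have l'u' j : l' 0 j <= u' 0 j.
  by rewrite !set_coordE; case: eqP => [//|_]; exact: proper_box_le.
have sub1 y : box l' u' y -> box l u' y.
  move=> By j; have := By j; rewrite !set_coordE; case: eqP => [->|//].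
  by move=> /andP[my ->]; rewrite (le_trans (ltW lm)).
have sub2 y : box l' u' y -> box l' u y.
  move=> By j; have := By j; rewrite !set_coordE; case: eqP => [->|//].
  by move=> /andP[-> ym]; rewrite (le_trans ym (ltW mu)).
have sub3 y : box l u' y -> box l u y.
  move=> By j; have := By j; rewrite !set_coordE; case: eqP => [->|//].
  by move=> /andP[-> ym]; rewrite (le_trans ym (ltW mu)).
have conv : convex (box l' u').
  move=> x y t Bx By /andP[t0 t1] j; rewrite segmentE.
  have /andP[h1 h2] := Bx j; have /andP[h3 h4] := By j.
  have e : x 0 j + t * (y 0 j - x 0 j) = (1 - t) * x 0 j + t * y 0 j by ring.
  rewrite e; apply/andP; split.
    have -> : l' 0 j = (1 - t) * l' 0 j + t * l' 0 j by ring.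
    by apply: lerD; apply: ler_wpM2l; rewrite ?subr_ge0.
  have -> : u' 0 j = (1 - t) * u' 0 j + t * u' 0 j by ring.
  by apply: lerD; apply: ler_wpM2l; rewrite ?subr_ge0.
pose c : 'rV[R]_n := \row_j ((l' 0 j + u' 0 j) / 2).
have [|||||t tE] := @sections_agree s1 s2 (box l' u') c cs1 cs2 conv.
- by move=> y /sub1/sub3; exact: proper_box_cube.
- by move=> y /sub1; exact: p1.
- by move=> y /sub2; exact: p2.
- move=> j; have := l'u' j; rewrite [c 0 j]mxE => h; apply/andP; split; lra.
- move=> j; have [l0 lu u1] := plu j; rewrite [c 0 j]mxE !set_coordE.
  case: eqP => [ji|_]; first subst j.
    apply/andP; split; lra.
  apply/andP; split; lra.
exists (fun y : 'rV[R]_n =>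
  if y 0 i <= m then s1 (clamp l u' y) else a t (s2 (clamp l' u y))).
  apply: (@continuous_glue R _ _ (fun y => s1 (clamp l u' y))
    (fun y => a t (s2 (clamp l' u y))) (fun y : 'rV[R]_n => y 0 i) m).
  - move=> y; apply: (@continuous_comp _ _ _ (clamp l u') s1); last exact: cs1.
    exact: continuous_clamp.
  - move=> y; apply: (@continuous_comp _ _ _ (s2 \o clamp l' u) (a t)); last first.
      exact: act_continuous.
    apply: (@continuous_comp _ _ _ (clamp l' u) s2); last exact: cs2.
    exact: continuous_clamp.
  - exact: continuous_coord.
  move=> y yi.
  have -> : clamp l' u y = clamp l u' y.
    apply/rowP => j; rewrite !mxE; case: eqP => [->|//]; rewrite yi.
    by rewrite min_r ?ltW // maxxx minxx max_r ?ltW.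
  apply: tE => j; rewrite !mxE; case: eqP => [->|/eqP ji].
    by rewrite yi minxx max_r ?lexx ?ltW.
  have := clamp_box y (proper_box_le plu) j; by rewrite mxE.
move=> y By; case: ifP => [ym|/negbT].
  have Bu' : box l u' y.
    move=> j; have /andP[ly yu] := By j; rewrite set_coordE ly /=.
    by case: eqP => [->|].
  by rewrite clamp_id // p1.
rewrite -ltNge => my.
have Bl' : box l' u y.
  move=> j; have /andP[ly yu] := By j; rewrite set_coordE yu andbT.
  by case: eqP => [->|//]; exact: ltW.
by rewrite clamp_id // (orbit_act pP) p2.
Qed.

(** Measure the i-th side of a box by a number N i of steps of length d.  If all
N i are at most 1 the box is small; otherwise cut off the last of N i equal parts
of a side with N i > 1.  The induction is on the total number of steps. *)
Lemma all_boxes_have_sections l u : proper_box l u -> section_over l u.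
Proof.
have [d d0 small] := small_boxes_have_sections.
suff H k : forall (N : 'I_n -> nat) l u, (\sum_i N i <= k)%N -> proper_box l u ->
    (forall i, u 0 i <= l 0 i + d *+ N i) -> section_over l u.
  move=> plu; pose N := (Num.bound (d^-1)).
  apply: (H _ (fun=> N) _ _ (leqnn _) plu) => i.
  have [l0 _ u1] := plu i; rewrite (le_trans u1) // -[leLHS]add0r lerD //.
  rewrite -mulr_natr -ler_pdivrMl // mulr1 ltW //.
  by apply: archi_boundP; rewrite invr_ge0 ltW.
elim: k => [|k IH] N {}l {}u Nk plu uN; have [small_N|] := boolP [forall i, (N i <= 1)%N].
- apply: small => // i; apply: (le_trans (uN i)); rewrite lerD2l.
  by have := forallP small_N i; case: (N i) => [|[|//]] _; rewrite ?mulr0n ?mulr1n // ltW.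
- rewrite negb_forall => /existsP[i]; rewrite -ltnNge.
  by move: Nk; rewrite leqn0 sum_nat_eq0 => /forallP/(_ i)/eqP->.
- apply: small => // i; apply: (le_trans (uN i)); rewrite lerD2l.
  by have := forallP small_N i; case: (N i) => [|[|//]] _; rewrite ?mulr0n ?mulr1n // ltW.
rewrite negb_forall => /existsP[i]; rewrite -ltnNge => Ni.
have [q Nq q0] : exists2 q, N i = q.+1 & (0 < q)%N.
  by case: (N i) Ni => [//|q] q0; exists q.
have q1 : 0 < q.+1%:R :> R by rewrite ltr0n.
have qn : 0 < q%:R :> R by rewrite ltr0n.
(* Cut the i-th side, of at most q + 1 steps, in the ratio q : 1. *)
pose w := (u 0 i - l 0 i) / q.+1%:R.
have [l0 lu u1] := plu i.
have w0 : 0 < w by rewrite divr_gt0 // subr_gt0.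
have wd : w <= d.
  by rewrite /w ler_pdivrMr // lerBlDl mulr_natr -Nq.
have uE : u 0 i = l 0 i + w * q%:R + w.
  have : w * q.+1%:R = u 0 i - l 0 i by rewrite /w mulfVK // gt_eqF.
  by rewrite -natr1; lra.
have wq : 0 < w * q%:R by rewrite mulr_gt0.
have sumN (N' : 'I_n -> nat) : (N' i < N i)%N -> (forall j, j != i -> N' j = N j) ->
    (\sum_j N' j <= k)%N.
  move=> N'i N'j; rewrite -ltnS (leq_trans _ Nk) //.
  by rewrite (bigD1 i) //= [X in (_ < X)%N](bigD1 i) //= (eq_bigr N) // ltn_add2r.
apply: (@glue_sections l u i (l 0 i + w * q%:R)) => //; rewrite ?ltrDl // ?uE ?ltrDl //.
  apply: (IH (fun j => if j == i then q else N j)).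
  - by apply: sumN => [|j /negPf->//]; rewrite eqxx Nq.
  - move=> j; rewrite set_coordE; case: eqP => [->|_]; last exact: plu.
    by split=> //; lra.
  - move=> j; rewrite set_coordE /=; case: eqP => [->|_]; last exact: uN.
    by rewrite lerD2l -[d *+ q]mulr_natr ler_wpM2r // ltW.
apply: (IH (fun j => if j == i then 1%N else N j)).
- by apply: sumN => [|j /negPf->//]; rewrite eqxx Nq ltnS.
- move=> j; rewrite set_coordE; case: eqP => [->|_]; last exact: plu.
  by split=> //; lra.
- move=> j; rewrite set_coordE /=; case: eqP => [->|_]; last exact: uN.
  by rewrite uE lerD2l mulr1n.
Qed.

Lemma global_section : exists2 s : 'rV[R]_n -> M, continuous s &
  forall y, cube y -> p (s y) = y.
Proof.
have [|s cs ps] := @all_boxes_have_sections (const_mx 0) (const_mx 1).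
  by move=> i; rewrite !mxE lexx ltr01.
by exists s => // y cy; apply: ps => i; rewrite !mxE; exact: cy.
Qed.

End GlobalSection.

(** * Homeomorphisms from equivalent characteristic functions *)

Section CubeSymmetry.
Variables (R : realType) (n : nat).
Implicit Types (y : 'rV[R]_n) (F : facet n) (s : {perm facet n}).

(** A symmetry of the cube permutes these 2n functions, while it takes a coordinate
to a coordinate or to 1 minus a coordinate. *)
Definition facet_coord F y : R := if F.2 then y 0 F.1 else 1 - y 0 F.1.

(** The coordinates of the image are the facet functions of the preimages under s of
the upper facets; those of the lower facets follow. *)
Definition cube_symmetry s y : 'rV[R]_n := \row_j facet_coord ((s^-1)%g (j, true)) y.

Lemma facets_at_coord F y : (F \in facets_at y) = (facet_coord F y == 1).
Proof.
case: F => i []; rewrite inE /facet_coord //=.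
by apply/eqP/eqP => [->|h]; [rewrite subr0 | apply: (@subrI _ 1); rewrite subr0].
Qed.

Lemma facet_coord_opp F y : facet_coord (opposite_fun F) y = 1 - facet_coord F y.
Proof. by case: F => i []; rewrite /facet_coord /= ?subKr. Qed.

Lemma facet_coord_symmetry s F y : s \in cube_aut n ->
  facet_coord F (cube_symmetry s y) = facet_coord ((s^-1)%g F) y.
Proof.
rewrite -groupV => /cube_autP com; case: F => i []; rewrite {1}/facet_coord /= mxE //.
by rewrite (_ : (i, false) = opposite_fun (i, true)) // com facet_coord_opp.
Qed.

Lemma facets_at_symmetry s y : s \in cube_aut n ->
  facets_at (cube_symmetry s y) = s @: facets_at y.
Proof.
move=> sA; apply/setP => F; rewrite facets_at_coord facet_coord_symmetry //.
rewrite -facets_at_coord; apply/idP/imsetP => [Fy|[G Gy ->]]; last by rewrite permK.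
by exists ((s^-1)%g F); rewrite ?permKV.
Qed.

Lemma cube_symmetryK s y : s \in cube_aut n ->
  cube_symmetry (s^-1)%g (cube_symmetry s y) = y.
Proof.
move=> sA; apply/rowP => j; rewrite mxE facet_coord_symmetry //.
by rewrite invgK permK.
Qed.

Lemma facet_coord_itv F y : cube y -> 0 <= facet_coord F y <= 1.
Proof.
move=> /(_ F.1) /andP[y0 y1]; rewrite /facet_coord; case: F.2; rewrite ?y0 //.
by rewrite subr_ge0 y1 lerBlDr lerDl y0.
Qed.

Lemma cube_symmetry_cube s y : cube y -> cube (cube_symmetry s y).
Proof. by move=> cy i; rewrite mxE facet_coord_itv. Qed.

Lemma continuous_symmetry s : continuous (cube_symmetry s).
Proof.
move=> y; apply: continuous_row => i.
rewrite (_ : (fun _ => _) = facet_coord ((s^-1)%g (i, true))); last first.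
  by apply/funext => z; rewrite mxE.
rewrite /facet_coord; case: (_.2); first exact: continuous_coord.
set j := _.1; apply: (@continuous_comp _ _ _ (fun y : 'rV[R]_n => y 0 j) (fun u : R => 1 - u)).
  exact: continuous_coord.
by apply: cvgB; [exact: cvg_cst | exact: cvg_id].
Qed.

End CubeSymmetry.

Section Classification.
Variables (R : realType) (n : nat).

(** Every point of M is a t (s y), and t is determined up to the isotropy group
over y, so the formula defines f.  The preimage of a closed set is a finite union
of compact sets, which gives the continuity. *)
Lemma equivariant_map_of_sections (M N : smooth_manifold R n)
    (a : Z2_action n M) (b : Z2_action n N) (p : M -> 'rV[R]_n)
    (s : 'rV[R]_n -> M) (s' : 'rV[R]_n -> N) (phi : 'rV[R]_n -> 'rV[R]_n) :
  orbit_map_onto_cube a p -> continuous s -> continuous s' -> continuous phi ->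
  (forall y, cube y -> p (s y) = y) ->
  (forall y t, cube y -> a t (s y) = s y -> b t (s' (phi y)) = s' (phi y)) ->
  exists2 f : M -> N, continuous f &
    forall t y, cube y -> f (a t (s y)) = b t (s' (phi y)).
Proof.
move=> pP cs cs' cphi ps stab.
have /choice[t tP] : forall x, exists t, a t (s (p x)) = x.
  by move=> x; apply/(orbit_mapP pP); rewrite ps //; exact: (orbit_cube pP).
pose f x := b (t x) (s' (phi (p x))).
have fE u y : cube y -> f (a u (s y)) = b u (s' (phi y)).
  move=> cy; rewrite /f (orbit_act pP) ps //; set v := t _.
  have : a v (s y) = a u (s y) by have := tP (a u (s y)); rewrite (orbit_act pP) ps.
  move=> uv; have : a (u + v) (s y) = s y by rewrite actD uv; exact: act_inv.
  by move/(stab _ _ cy); rewrite actD => {2}<-; rewrite act_inv.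
exists f => //; apply/continuous_closedP => C cC.
pose B u := cube (R := R) (n := n) `&` ((fun y => b u (s' (phi y))) @^-1` C).
have -> : f @^-1` C = \bigcup_(u in [set: 'rV['F_2]_n]) ((fun y => a u (s y)) @` B u).
  apply/seteqP; split=> [x Cx|x [u _ [y [cy Cy] <-]]]; last by rewrite /preimage /= fE.
  exists (t x) => //; exists (p x); last exact: tP.
  by split; [exact: (orbit_cube pP) | rewrite /preimage /= -fE ?tP //; exact: (orbit_cube pP)].
apply: closed_bigcup; first exact: finite_finset.
move=> u _; apply: compact_closed; first exact: mfd_hausdorff.
apply: continuous_compact.
  apply: continuous_subspaceT => y; apply: (@continuous_comp _ _ _ s (a u)); first exact: cs.
  exact: act_continuous.
apply: (@subclosed_compact _ _ (cube (R := R) (n := n))); last by move=> y [].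
  apply: closedI.
    by apply: compact_closed; [exact: hausdorff_row | exact: compact_cube].
  apply: (continuous_closedP (fun y => b u (s' (phi y)))).1 => // y.
  apply: (@continuous_comp _ _ _ (s' \o phi) (b u)); last exact: act_continuous.
  by apply: (@continuous_comp _ _ _ phi s'); [exact: cphi | exact: cs'].
exact: compact_cube.
Qed.

Lemma relabel_stab (M N : smooth_manifold R n) (a : Z2_action n M) (b : Z2_action n N)
    p q lam mu s x x' :
  char_fun_for a p lam -> char_fun_for b q mu -> s \in cube_aut n ->
  mu = relabel lam s -> q x' = cube_symmetry s (p x) ->
  forall t, a t x = x -> b t x' = x'.
Proof.
move=> [_ al] [_ bl] sA muE qx t /al[S Sx ->]; apply/bl.
exists (s @: S); first by rewrite qx facets_at_symmetry // imsetS.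
rewrite big_imset /=; last by move=> F G _ _; exact: perm_inj.
by apply: eq_bigr => F _; rewrite muE ffunE permK.
Qed.

(** The maps built from a symmetry and from its inverse are inverse to each other
on the points a t (s y). *)
Lemma relabel_homeomorphic (M N : small_cover_over_cube R n) p q lam mu s :
  orbit_map_onto_cube (sc_act M) p -> orbit_map_onto_cube (sc_act N) q ->
  char_fun_for (sc_act M) p lam -> char_fun_for (sc_act N) q mu ->
  s \in cube_aut n -> mu = relabel lam s -> equivariantly_homeomorphic M N.
Proof.
move=> pP qP lamP muP sA muE.
have [sM cM pM] := global_section (@sc_locally_standard _ _ M) pP.
have [sN cN pN] := global_section (@sc_locally_standard _ _ N) qP.
have sVA : (s^-1)%g \in cube_aut n by rewrite groupV.
have lamE : lam = relabel mu (s^-1)%g.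
  by apply/ffunP => F; rewrite muE !ffunE invgK permK.
have [f cf fE] : exists2 f : M -> N, continuous f & forall t y, cube y ->
    f (sc_act M t (sM y)) = sc_act N t (sN (cube_symmetry s y)).
  apply: (equivariant_map_of_sections pP cM cN (@continuous_symmetry R n s) pM).
  move=> y t cy; apply: (relabel_stab lamP muP sA muE).
  by rewrite pN ?pM //; exact: cube_symmetry_cube.
have [g cg gE] : exists2 g : N -> M, continuous g & forall t y, cube y ->
    g (sc_act N t (sN y)) = sc_act M t (sM (cube_symmetry (s^-1)%g y)).
  apply: (equivariant_map_of_sections qP cN cM (@continuous_symmetry R n (s^-1)%g) pN).
  move=> y t cy; apply: (relabel_stab muP lamP sVA lamE).
  by rewrite pN ?pM //; exact: cube_symmetry_cube.
have liftM x : exists t y, cube y /\ x = sc_act M t (sM y).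
  have /(orbit_mapP pP)[t tx] : p (sM (p x)) = p x by rewrite pM //; exact: (orbit_cube pP).
  by exists t, (p x); split; [exact: (orbit_cube pP) | ].
have liftN x : exists t y, cube y /\ x = sc_act N t (sN y).
  have /(orbit_mapP qP)[t tx] : q (sN (q x)) = q x by rewrite pN //; exact: (orbit_cube qP).
  by exists t, (q x); split; [exact: (orbit_cube qP) | ].
exists f, g; split=> // [x|x|t x].
- have [t [y [cy ->]]] := liftM x; rewrite fE // gE ?cube_symmetryK //.
  exact: cube_symmetry_cube.
- have [t [y [cy ->]]] := liftN x; rewrite gE // fE; last exact: cube_symmetry_cube.
  by rewrite -{1}[s]invgK cube_symmetryK.
- have [u [y [cy ->]]] := liftM x; by rewrite -actD !fE // actD.
Qed.

End Classification.

(** * Equivalent characteristic functions from homeomorphisms *)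

Lemma char_fun_generator (R : realType) n (M : smooth_manifold R n)
    (a : Z2_action n M) p lam :
  char_fun_for a p lam -> stab_generator a p lam.
Proof.
move=> [_ al] F x [_ Fx] t; rewrite al Fx; split.
  by case=> S; rewrite subset1 => /orP[] /eqP -> ->; [right | left];
    rewrite ?big_set1 ?big_set0.
case=> ->; first by exists finset.set0; rewrite ?finset.sub0set // big_set0.
by exists [set F]%SET; rewrite ?big_set1.
Qed.

(** It belongs to a basis. *)
Lemma char_neq0 n (lam : char_fun n) F : is_char lam -> lam F != 0.
Proof.
case: F => i b /forallP/(_ [ffun=> b]); rewrite -row_free_unit => /row_free_inj inj.
apply/eqP => l0; have := inj 1%N (delta_mx 0 i) 0.
rewrite -rowE rowK ffunE mul0mx => /(_ l0)/rowP/(_ i)/eqP.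
by rewrite !mxE !eqxx oner_eq0.
Qed.

Section FacetMap.
Variables (R : realType) (n : nat) (M N : smooth_manifold R n).
Variables (a : Z2_action n M) (b : Z2_action n N).
Variables (p : M -> 'rV[R]_n) (q : N -> 'rV[R]_n) (f : M -> N).
Hypotheses (a_std : locally_standard a) (b_std : locally_standard b).
Hypotheses (pP : orbit_map_onto_cube a p) (qP : orbit_map_onto_cube b q).
Hypotheses (f_cont : continuous f) (f_inj : injective f).
Hypothesis f_equi : forall t x, f (a t x) = b t (f x).

Lemma equivariant_stab t x : a t x = x <-> b t (f x) = f x.
Proof. by rewrite -f_equi; split=> [->|/f_inj]. Qed.

(** The order of the isotropy group is 2 to the codimension. *)
Lemma equivariant_codim x : cube_codim (q (f x)) = cube_codim (p x).
Proof.
apply/eqP; rewrite -(eqn_exp2l _ _ (ltnSn 1)) -(card_stab_orbit a_std pP).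
rewrite -(card_stab_orbit b_std qP); apply/eqP/eq_card => t; rewrite !inE.
by apply/asboolP/asboolP => /equivariant_stab.
Qed.

Lemma equivariant_orbit x y : p x = p y -> q (f x) = q (f y).
Proof. by move/(orbit_mapP pP) => [t <-]; rewrite f_equi (orbit_act qP). Qed.

(** Let q (f x0) lie in the facet G for the point x0 over the center of F.  Over
the relative interior of F the points q (f x) have codimension 1, and the facet
that they lie in is locally constant, so it is always G.  The whole facet F is
the closure of its relative interior, and G is closed. *)
Lemma facet_map : exists sigma : facet n -> facet n, forall F x,
  F \in facets_at (p x) -> sigma F \in facets_at (q (f x)).
Proof.
suff /choice[sigma sP] : forall F, exists G, forall x, F \in facets_at (p x) ->
    G \in facets_at (q (f x)) by exists sigma.
move=> F.
have one_facet x : open_facet F (p x) -> exists H, facets_at (q (f x)) = [set H]%SET.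
  move=> Fx; have /eqP/cards1P[H HP] : #|facets_at (q (f x))| = 1%N.
    by rewrite -cube_codimE equivariant_codim (codim_open_facet Fx).
  by exists H.
have [x0 px0] := orbit_surj pP (facet_centerP R F).1.
have F0 : open_facet F (p x0) by rewrite px0; exact: facet_centerP.
have [G GP] := one_facet _ F0; exists G => x.
pose Q y := forall x, p x = y -> G \in facets_at (q (f x)).
have near_q x1 : \forall x' \near x1, facets_at (q (f x')) \subset facets_at (q (f x1)).
  apply: (@near_comp _ _ _ (q \o f) (fun y => facets_at y \subset facets_at (q (f x1)))).
    apply: continuous_comp; first exact: f_cont.
    exact: (orbit_continuous qP).
  exact: near_facets_at.
have Q_open y : open_facet F y -> Q y.
  move=> Fy; apply: (@convex_locally_constant R n (open_facet F) Q
    (@convex_open_facet R n F) _ (p x0)) => //; last first.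
    by move=> x' /equivariant_orbit ->; rewrite GP inE.
  move=> {Fy}y Fy; have [z pz] := orbit_surj pP Fy.1.
  have Fz : open_facet F (p z) by rewrite pz.
  have [H HP] := one_facet _ Fz.
  have := orbit_open pP (near_q z); rewrite pz; apply: near_mono => y' + Fy'.
  move=> /(_ Fy'.1)[z' pz' qz'].
  have Fz' : open_facet F (p z') by rewrite pz'.
  have qz'H : facets_at (q (f z')) = [set H]%SET.
    have [H' H'P] := one_facet _ Fz'; move: qz'; rewrite H'P HP finset.sub1set inE.
    by move/eqP->.
  have QE w y1 K : p w = y1 -> facets_at (q (f w)) = [set K]%SET -> Q y1 <-> G = K.
    move=> pw wK; split=> [/(_ _ pw)|GK w' pw']; first by rewrite wK inE => /eqP.
    by rewrite (@equivariant_orbit _ w) ?wK ?inE ?GK // pw'.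
  by rewrite (QE _ _ _ pz' qz'H) (QE _ _ _ pz HP).
move=> Fx; apply: contraT => GN.
have : \forall x' \near x, G \notin facets_at (q (f x')).
  apply: near_mono (near_q x) => x' /fintype.subsetP sub.
  by apply: contra GN; exact: sub.
move=> /(orbit_open pP)/(near_segment (facet_center R F))[t /andP[t0 t1] H].
have cy : open_facet F (segment (facet_center R F) (p x) t).
  have /open_facetP[cF ci] := facet_centerP R F; apply/open_facetP.
  split=> [|i iF]; rewrite segmentE.
    by rewrite cF; move: Fx; rewrite inE => /eqP->; rewrite subrr mulr0 addr0.
  apply: interior_segment; rewrite ?t0 ?ci //; exact: (orbit_cube pP).
have [x' px' /negP[]] := H cy.1.
by apply: (Q_open _ cy).
Qed.

End FacetMap.

Lemma facet_opp n (F G : facet n) : F.1 = G.1 -> F = G \/ F = opposite_fun G.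
Proof.
by case: F G => i c [j d] /= ->; case: c d => [] []; [left|right|right|left].
Qed.

(** The facet maps of f and g are inverse to each other.  They preserve opposite
facets, for if the images of F and of its opposite met in a point, the image of
this point under g would lie in both F and its opposite.  Labels are preserved
since f preserves isotropy groups. *)
Lemma homeomorphic_relabel (R : realType) n (M N : smooth_manifold R n)
    (a : Z2_action n M) (b : Z2_action n N) p q lam mu (f : M -> N) (g : N -> M) :
  locally_standard a -> locally_standard b ->
  orbit_map_onto_cube a p -> orbit_map_onto_cube b q ->
  char_fun_for a p lam -> char_fun_for b q mu ->
  cancel f g -> cancel g f -> continuous f -> continuous g ->
  (forall t x, f (a t x) = b t (f x)) ->
  exists2 s, s \in cube_aut n & mu = relabel lam s.
Proof.
move=> a_std b_std pP qP lamP muP fK gK cf cg fE.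
have gE t x : g (b t x) = a t (g x) by rewrite -{1}[x]gK -fE fK.
have [sg sgP] := facet_map a_std b_std pP qP cf (can_inj fK) fE.
have [tu tuP] := facet_map b_std a_std qP pP cg (can_inj gK) gE.
have center F : exists x, open_facet F (p x).
  have [x px] := orbit_surj pP (facet_centerP R F).1.
  by exists x; rewrite px; exact: facet_centerP.
have sgK : cancel sg tu.
  move=> F; have [x [_ Fx]] := center F.
  have /sgP/tuP : F \in facets_at (p x) by rewrite Fx inE.
  by rewrite fK Fx inE => /eqP.
have sg_opp F : sg (opposite_fun F) = opposite_fun (sg F).
  have [/facet_opp[/(can_inj sgK)|//]|ne] := eqVneq (sg (opposite_fun F)).1 (sg F).1.
    by case: F => i [].
  (* Otherwise the two images meet, for instance in the vertex v. *)
  pose v := [ffun i => if i == (sg F).1 then (sg F).2 else (sg (opposite_fun F)).2].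
  have [x qx] := orbit_surj qP (cube_vertex R v).
  have h1 : sg F \in facets_at (q x).
    by rewrite qx facets_at_vertex ffunE eqxx.
  have h2 : sg (opposite_fun F) \in facets_at (q x).
    by rewrite qx facets_at_vertex ffunE (negPf ne).
  have := tuP _ _ h1; have := tuP _ _ h2; rewrite !sgK !inE /= => /eqP -> /eqP.
  by case: F.2 => /= /eqP; rewrite ?oner_eq0 // eq_sym oner_eq0.
exists (perm (can_inj sgK)).
  by apply/cube_autP => F; rewrite !permE sg_opp.
have musg F : mu (sg F) = lam F.
  have [x Fx] := center F.
  have sgF : open_facet (sg F) (q (f x)).
    split; first exact: (orbit_cube qP).
    have /eqP/cards1P[H HP] : #|facets_at (q (f x))| = 1%N.
      rewrite -cube_codimE (equivariant_codim a_std b_std pP qP (can_inj fK) fE).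
      exact: codim_open_facet Fx.
    have : sg F \in facets_at (q (f x)) by apply: sgP; rewrite Fx.2 inE.
    by rewrite HP inE => /eqP ->.
  have : a (lam F) x = x by apply/(char_fun_generator lamP Fx); right.
  rewrite (equivariant_stab (can_inj fK) fE) => /(char_fun_generator muP sgF)[l0|//].
  by have := char_neq0 F lamP.1; rewrite l0 eqxx.
apply/ffunP => F; rewrite ffunE -{1}[F](permKV (perm (can_inj sgK))) permE.
by rewrite musg.
Qed.

(** * Coordinates for the small cover of a characteristic function *)

Section ModelAlgebra.
Variables (R : realType) (n : nat) (lam : char_fun n).
Implicit Types (y z : 'rV[R]_n) (t : 'rV['F_2]_n) (chi : 'cV['F_2]_n).
Implicit Type v : {ffun 'I_n -> bool}.

Definition pairing t chi : 'F_2 := (t *m chi) 0 0.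

Lemma pairingDl t t' chi : pairing (t + t') chi = pairing t chi + pairing t' chi.
Proof. by rewrite /pairing mulmxDl mxE. Qed.

Definition F2sign (e : 'F_2) : R := if e == 0 then 1 else -1.

Lemma F2cases (e : 'F_2) : e = 0 \/ e = 1.
Proof. by have [->|] := eqVneq e 0; [left | rewrite F2_neq0 => /eqP->; right]. Qed.

Lemma F2sign0 : F2sign 0 = 1. Proof. by rewrite /F2sign eqxx. Qed.
Lemma F2sign1 : F2sign 1 = -1. Proof. by rewrite /F2sign oner_eq0. Qed.

Lemma F2signD e e' : F2sign (e + e') = F2sign e * F2sign e'.
Proof.
case: (F2cases e) (F2cases e') => -> [] ->; rewrite ?F2_addxx ?addr0 ?add0r;
by rewrite ?F2sign0 ?F2sign1 ?mulr1 ?mul1r ?mulrNN ?mulr1.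
Qed.

Lemma normr_F2sign e : `|F2sign e| = 1.
Proof. by rewrite /F2sign; case: ifP; rewrite ?normrN normr1. Qed.

Lemma F2sign_neg (x : R) : F2sign (x < 0)%R%:R * `|x| = x.
Proof.
by case: ltP => x0; rewrite ?F2sign1 ?F2sign0 ?mulN1r ?mul1r;
  [rewrite ltr0_norm ?opprK | rewrite ger0_norm].
Qed.

(** The distance to F, which is the coordinate of the opposite facet. *)
Definition facet_dist F y : R := facet_coord (opposite_fun F) y.

Lemma facet_distE F y : facet_dist F y = 1 - facet_coord F y.
Proof. exact: facet_coord_opp. Qed.

Lemma facet_dist_itv F y : cube y -> 0 <= facet_dist F y <= 1.
Proof. exact: facet_coord_itv. Qed.

Lemma facet_dist_eq0 F y : (facet_dist F y == 0) = (F \in facets_at y).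
Proof. by rewrite facet_distE subr_eq0 eq_sym facets_at_coord. Qed.

Lemma facet_dist_opp F y : facet_dist (opposite_fun F) y = 1 - facet_dist F y.
Proof. exact: facet_coord_opp. Qed.

Lemma continuous_facet_dist F : continuous (facet_dist F).
Proof.
rewrite /facet_dist /facet_coord; case: (_.2) => /=; first exact: continuous_coord.
move=> y; apply: (@continuous_comp _ _ _ (fun y : 'rV[R]_n => y 0 F.1) (fun u : R => 1 - u)).
  exact: continuous_coord.
by apply: cvgB; [exact: cvg_cst | exact: cvg_id].
Qed.

Definition near_facet v j : facet n := (j, v j).
Definition far_facet v j : facet n := (j, ~~ v j).

Lemma facet_dist_far v j y :
  facet_dist (far_facet v j) y = 1 - facet_dist (near_facet v j) y.
Proof. exact: (facet_dist_opp (near_facet v j)). Qed.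

(** Each direction has one facet through the vertex v and one away from it. *)
Lemma prod_facets v (P : pred (facet n)) (D : facet n -> R) :
  \prod_(F | P F) D F =
  (\prod_(j | P (near_facet v j)) D (near_facet v j)) *
  \prod_(j | P (far_facet v j)) D (far_facet v j).
Proof.
rewrite !(big_mkcond P) !(big_mkcond (fun j => P _)) -big_split /=.
rewrite (eq_bigr (fun F => (fun i b => if P (i, b) then D (i, b) else 1) F.1 F.2));
  last by case.
rewrite -(pair_bigA _ (fun i b => if P (i, b) then D (i, b) else 1)) /=.
apply: eq_bigr => j _; rewrite big_bool /near_facet /far_facet.
by case: (v j) => //=; rewrite mulrC.
Qed.

(** The value at the point (t, y) of Z_2^n x I^n of the function attached to the
character chi.  It does not change when t is changed by lam F for a facet F
through y: either chi is trivial on lam F, or the product vanishes. *)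
Definition fiber_val t y chi : R :=
  F2sign (pairing t chi) * \prod_(F | pairing (lam F) chi != 0) facet_dist F y.

(** The coordinates of t in the basis that lam gives at the vertex v. *)
Definition vertex_coords v t : 'rV['F_2]_n := t *m invmx (vertex_mx lam v).

Definition dual_chi v i : 'cV['F_2]_n := col i (invmx (vertex_mx lam v)).

Lemma pairing_dual v t i : pairing t (dual_chi v i) = vertex_coords v t 0 i.
Proof. by rewrite /pairing /vertex_coords !mxE; apply: eq_bigr => j _; rewrite mxE. Qed.

(** The coordinates of (t, y) in the chart around the vertex v. *)
Definition signed_dist v t y : 'rV[R]_n :=
  \row_j (F2sign (vertex_coords v t 0 j) * facet_dist (near_facet v j) y).

Lemma signed_distE v t y j :
  signed_dist v t y 0 j = F2sign (vertex_coords v t 0 j) * facet_dist (near_facet v j) y.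
Proof. by rewrite mxE. Qed.

(** The functions of fiber_val in terms of the chart coordinates z around v. *)
Definition chart_formula v z y chi : R :=
  (\prod_(j | pairing (lam (near_facet v j)) chi != 0) z 0 j) *
  \prod_(j | pairing (lam (far_facet v j)) chi != 0) facet_dist (far_facet v j) y.

Hypothesis lam_char : is_char lam.

Lemma vertex_unit v : vertex_mx lam v \in unitmx.
Proof. by have /forallP := lam_char; apply. Qed.

Lemma vertex_coordsK v t : vertex_coords v t *m vertex_mx lam v = t.
Proof. by rewrite /vertex_coords mulmxKV // vertex_unit. Qed.

Lemma vertex_coordsD v t t' :
  vertex_coords v (t + t') = vertex_coords v t + vertex_coords v t'.
Proof. by rewrite /vertex_coords mulmxDl. Qed.

Lemma vertex_coords_near v j : vertex_coords v (lam (near_facet v j)) = delta_mx 0 j.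
Proof.
have -> : lam (near_facet v j) = row j (vertex_mx lam v) by rewrite rowK.
by rewrite rowE /vertex_coords mulmxK // vertex_unit.
Qed.

Lemma pairing_near_dual v i j : pairing (lam (near_facet v j)) (dual_chi v i) = (i == j)%:R.
Proof. by rewrite pairing_dual vertex_coords_near mxE eqxx. Qed.

Lemma F2sign_sum (I : finType) (f : I -> 'F_2) :
  F2sign (\sum_i f i) = \prod_i F2sign (f i).
Proof. by rewrite (big_morph F2sign F2signD F2sign0). Qed.

(** Expand t in the basis at the vertex v. *)
Lemma sign_pairing v t chi : F2sign (pairing t chi) =
  \prod_(j | pairing (lam (near_facet v j)) chi != 0) F2sign (vertex_coords v t 0 j).
Proof.
rewrite -{1}(vertex_coordsK v t) {1}/pairing -mulmxA mxE F2sign_sum [RHS]big_mkcond.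
apply: eq_bigr => j _.
have -> : (vertex_mx lam v *m chi) j 0 = pairing (lam (near_facet v j)) chi.
  by rewrite /pairing -[lam _](rowK (fun j => lam (j, v j))) -row_mul [RHS]mxE.
by case: (F2cases (pairing (lam (near_facet v j)) chi)) => ->;
  rewrite ?eqxx ?oner_eq0 ?mulr0 ?mulr1 ?F2sign0.
Qed.

(** The sign of the character is the product of the signs of the coordinates that
it involves, and their absolute values are the distances to the facets near v. *)
Lemma fiber_val_chart v t y chi :
  fiber_val t y chi = chart_formula v (signed_dist v t y) y chi.
Proof.
rewrite /fiber_val (prod_facets v) (sign_pairing v) mulrA -big_split /=.
by rewrite /chart_formula; congr (_ * _); apply: eq_bigr => j _; rewrite ?mxE.
Qed.

(** The dual basis at v recovers the chart coordinates, up to the distances to the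
facets away from v, which do not vanish around v. *)
Lemma chart_formula_dual v z y i : chart_formula v z y (dual_chi v i) =
  z 0 i * \prod_(j | pairing (lam (far_facet v j)) (dual_chi v i) != 0)
    facet_dist (far_facet v j) y.
Proof.
rewrite /chart_formula; congr (_ * _); rewrite (bigD1 i) /=; last first.
  by rewrite pairing_near_dual eqxx oner_eq0.
rewrite big1 ?mulr1 // => j; rewrite pairing_near_dual.
by case: (eqVneq j i) => _; rewrite ?andbF /= ?eqxx.
Qed.

Lemma fiber_val_act t t' y chi :
  fiber_val (t + t') y chi = F2sign (pairing t chi) * fiber_val t' y chi.
Proof. by rewrite /fiber_val pairingDl F2signD mulrA. Qed.

(** The pair (fold_elt v z, fold_point v z) represents the point with coordinates z
in the chart around v. *)
Definition fold_point v z : 'rV[R]_n := \row_j (if v j then 1 - `|z 0 j| else `|z 0 j|).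
Definition fold_elt v z : 'rV['F_2]_n :=
  indicator_row [set j | z 0 j < 0]%SET *m vertex_mx lam v.

Lemma facet_dist_fold v z j : facet_dist (near_facet v j) (fold_point v z) = `|z 0 j|.
Proof. by rewrite /facet_dist /facet_coord /= mxE; case: (v j); rewrite //= subKr. Qed.

Lemma fold_elt_coords v z j : vertex_coords v (fold_elt v z) 0 j = (z 0 j < 0)%R%:R.
Proof. by rewrite /vertex_coords /fold_elt mulmxK ?vertex_unit // mxE inE. Qed.

Lemma signed_dist_fold v z : signed_dist v (fold_elt v z) (fold_point v z) = z.
Proof. by apply/rowP => j; rewrite mxE facet_dist_fold fold_elt_coords F2sign_neg. Qed.

Lemma fold_point_signed v t y : cube y -> fold_point v (signed_dist v t y) = y.
Proof.
move=> cy; apply/rowP => j; rewrite !mxE normrM normr_F2sign mul1r.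
have /andP[d0 d1] := facet_dist_itv (near_facet v j) cy; rewrite ger0_norm //.
by rewrite /facet_dist /facet_coord /=; case: (v j); rewrite //= subKr.
Qed.

Lemma fold_point_cube v z : (forall j, `|z 0 j| <= 1) -> cube (fold_point v z).
Proof.
move=> z1 j; rewrite mxE; case: (v j); rewrite ?normr_ge0 ?z1 //.
by rewrite subr_ge0 z1 lerBlDr lerDl normr_ge0.
Qed.

Lemma continuous_fold_point v : continuous (fold_point v).
Proof.
move=> z; apply: continuous_row => j.
rewrite (_ : (fun _ => _) = fun z : 'rV[R]_n =>
  (fun u : R => if v j then 1 - `|u| else `|u|) (z 0 j)); last first.
  by apply/funext => w; rewrite mxE.
apply: (@continuous_comp _ _ _ (fun y : 'rV[R]_n => y 0 j)
  (fun u : R => if v j then 1 - `|u| else `|u|)); first exact: continuous_coord.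
case: (v j); last exact: norm_continuous.
by apply: cvgB; [exact: cvg_cst | exact: norm_continuous].
Qed.

(** The open stars of the vertices cover the cube: round each coordinate that is
not 1 down to 0. *)
Lemma near_vertex y : exists v, forall j, facet_dist (far_facet v j) y != 0.
Proof.
exists [ffun j => y 0 j == 1] => j.
rewrite /facet_dist /facet_coord /far_facet /= ffunE negbK.
by have [->|y1] := eqVneq (y 0 j) 1; rewrite ?oner_eq0 // subr_eq0 eq_sym.
Qed.

(** The functions attached to the characters separate the orbits of the spans of
the labels.  Around a vertex v near y the dual basis at v shows that t only
involves the labels of facets at distance 0. *)
Lemma stab_fiber_val t y :
  (forall chi, fiber_val t y chi = fiber_val 0 y chi) <->
  exists2 S : {set facet n}, S \subset facets_at y & t = \sum_(F in S) lam F.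
Proof.
split=> [stab|[S Sy ->] chi].
  have [v vy] := near_vertex y.
  exists (near_facet v @: F2support (vertex_coords v t)).
    apply/fintype.subsetP => _ /imsetP[j jt ->]; rewrite -facet_dist_eq0.
    have := stab (dual_chi v j); rewrite !(fiber_val_chart v) !chart_formula_dual => /eqP.
    rewrite -subr_eq0 -mulrBl mulf_eq0 => /orP[|]; last first.
      by move/prodf_eq0 => -[k _]; rewrite (negPf (vy k)).
    rewrite !signed_distE -mulrBl mulf_eq0 => /orP[|//].
    move: jt; rewrite inE F2_neq0 => /eqP->.
    rewrite /vertex_coords mul0mx mxE F2sign0 F2sign1 subr_eq0 eq_sym -subr_eq0 opprK.
    by rewrite -mulr2n mulrn_eq0 oner_eq0.
  rewrite big_imset /=; last by move=> j k _ _ [].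
  rewrite -{1}(vertex_coordsK v t) mulmx_sum_row big_mkcond.
  rewrite [RHS]big_mkcond /=; apply: eq_bigr => j _; rewrite rowK inE.
  by case: (F2cases (vertex_coords v t 0 j)) => ->; rewrite ?eqxx ?oner_eq0 ?scale0r ?scale1r.
elim/big_rec: _ => [//|F t' FS IH].
rewrite fiber_val_act IH /fiber_val mulrCA; congr (_ * _).
have [->|F1] := eqVneq (pairing (lam F) chi) 0; first by rewrite F2sign0 mul1r.
rewrite (bigD1 F) //= (_ : facet_dist F y = 0) ?mul0r ?mulr0 //.
by apply/eqP; rewrite facet_dist_eq0; exact: (fintype.subsetP Sy).
Qed.

End ModelAlgebra.

(** * The space and the action *)

Lemma continuous_prod_at (R : realType) (T : topologicalType) (I : finType) (P : pred I)
    (f : I -> T -> R) x : (forall i, P i -> {for x, continuous (f i)}) ->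
  {for x, continuous (fun y => \prod_(i | P i) f i y)}.
Proof. by move=> cf; apply: cvg_big => //; exact: mul_continuous. Qed.

Lemma continuous_scale (R : realType) (T : topologicalType) (c : R) (f : T -> R) x :
  {for x, continuous f} -> {for x, continuous (fun y => c * f y)}.
Proof. by move=> cf; apply: cvgM => //; exact: cvg_cst. Qed.

(** The topology of a subset is the initial one. *)
Lemma continuous_to_subtype (T X : topologicalType) (A : set X) (f : T -> A) x :
  {for x, continuous (fun y => val (f y))} -> {for x, continuous f}.
Proof.
move=> cf U [V /= [[W oW <-] Wfx] VU].
by apply: near_mono (near_comp cf (near_open oW Wfx)) => y Wy; exact: VU.
Qed.

Lemma continuous_val (X : topologicalType) (A : set X) : continuous (fun x : A => val x).
Proof. exact: initial_continuous. Qed.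

Lemma near_eq_continuous (T U : topologicalType) (f g : T -> U) x :
  (\forall y \near x, f y = g y) -> {for x, continuous g} -> {for x, continuous f}.
Proof.
move=> fg cg P /=; rewrite (nbhs_singleton fg) => nP.
have := near_and fg (near_comp cg nP).
by apply: near_mono => y [e Pg]; have : P (f y) by rewrite e.
Qed.

Section Model.
Variables (R : realType) (n : nat) (lam : char_fun n).
Implicit Types (y z : 'rV[R]_n) (t : 'rV['F_2]_n) (chi : 'cV['F_2]_n).
Implicit Type v : {ffun 'I_n -> bool}.

(** Coordinates of the ambient space: those of the cube, and one for each character
of Z_2^n. *)
Definition embed_index : finType := ('I_n + 'cV['F_2]_n)%type.

Definition embed t y : 'rV[R]_#|embed_index| :=
  \row_k match enum_val k : embed_index with
         | inl i => y 0 i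
         | inr chi => fiber_val lam t y chi
         end.

Definition model_set := [set u | exists t y, cube y /\ u = embed t y].

Definition model : topologicalType := model_set.

Definition position (m : model) : 'rV[R]_n :=
  \row_i (val m) 0 (enum_rank (inl i : embed_index)).
Definition fiber_coord (m : model) chi : R :=
  (val m) 0 (enum_rank (inr chi : embed_index)).

Lemma embed_in t y : cube y -> embed t y \in model_set.
Proof. by move=> cy; apply: mem_set; exists t, y. Qed.

Lemma clamp_unit_cube y : cube (clamp (const_mx 0) (const_mx 1) y).
Proof.
have := clamp_box y (a := const_mx 0) (b := const_mx 1); move=> H i.
by have := H _ i; rewrite !mxE; apply => j; rewrite !mxE ler01.
Qed.

Lemma clamp_unit_id y : cube y -> clamp (const_mx 0) (const_mx 1) y = y.
Proof. by move=> cy; apply: clamp_id => i; rewrite !mxE. Qed.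

(** Clamping to the cube makes this a total function of y. *)
Definition model_point t y : model := exist _ (embed t (clamp (const_mx 0) (const_mx 1) y))
  (embed_in t (clamp_unit_cube y)).

Lemma val_model_point t y : cube y -> val (model_point t y) = embed t y.
Proof. by move=> cy; rewrite /= clamp_unit_id. Qed.

Lemma position_point t y : cube y -> position (model_point t y) = y.
Proof. by move=> cy; apply/rowP => i; rewrite mxE val_model_point // mxE enum_rankK. Qed.

Lemma fiber_coord_point t y chi :
  cube y -> fiber_coord (model_point t y) chi = fiber_val lam t y chi.
Proof. by move=> cy; rewrite /fiber_coord val_model_point // mxE enum_rankK. Qed.

Lemma model_pointP (m : model) : exists t y, cube y /\ m = model_point t y.
Proof.
case: m => u uM; have [t [y [cy uE]]] := set_mem uM; exists t, y; split=> //.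
by apply: val_inj; rewrite val_model_point.
Qed.

Lemma position_cube m : cube (position m).
Proof. by have [t [y [cy ->]]] := model_pointP m; rewrite position_point. Qed.

Lemma model_ext (m m' : model) : position m = position m' ->
  (forall chi, fiber_coord m chi = fiber_coord m' chi) -> m = m'.
Proof.
move=> /rowP py fx; apply: val_inj; apply/rowP => k; rewrite -[k]enum_valK.
case: (enum_val k) => [i|chi]; last exact: fx.
by have := py i; rewrite !mxE.
Qed.

Lemma continuous_position : continuous position.
Proof.
move=> m; apply: continuous_row => i.
rewrite (_ : (fun _ => _) =
  fun m : model => val m 0 (enum_rank (inl i : embed_index))); last first.
  by apply/funext => w; rewrite mxE.
apply: (@continuous_comp _ _ _ (fun m : model => val m)
  (fun u : 'rV[R]_#|embed_index| => u 0 (enum_rank (inl i : embed_index)))).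
  exact: continuous_val.
exact: continuous_coord.
Qed.

Lemma continuous_fiber_coord chi : continuous (fiber_coord^~ chi).
Proof.
move=> m.
apply: (@continuous_comp _ _ _ (fun m : model => val m)
  (fun u : 'rV[R]_#|embed_index| => u 0 (enum_rank (inr chi : embed_index)))).
  exact: continuous_val.
exact: continuous_coord.
Qed.

Lemma continuous_to_model (T : topologicalType) (f : T -> model) x :
  {for x, continuous (position \o f)} ->
  (forall chi, {for x, continuous (fun w : T => fiber_coord (f w) chi)}) ->
  {for x, continuous f}.
Proof.
move=> cp cf; apply: continuous_to_subtype; apply: continuous_row => k.
rewrite -[k]enum_valK; case: (enum_val k) => [i|chi]; last exact: cf.
have <- : (fun y : T => position (f y) 0 i) =
    (fun y : T => val (f y) 0 (enum_rank (inl i : embed_index))).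
  by apply/funext => w; rewrite mxE.
apply: (@continuous_comp _ _ _ (position \o f) (fun y : 'rV[R]_n => y 0 i)) => //.
exact: continuous_coord.
Qed.

Lemma model_hausdorff : hausdorff_space model.
Proof.
rewrite open_hausdorff => m m' mm'.
have := @hausdorff_row R #|embed_index|; rewrite open_hausdorff.
have vmm' : val m != val m' by [].
case/(_ _ _ vmm') => -[A B] /= [/set_mem Am /set_mem Bm'] [oA oB /eqP AB].
exists ((fun m : model => val m) @^-1` A, (fun m : model => val m) @^-1` B) => /=.
  by split; apply: mem_set.
split.
- by apply: open_comp => // x _; exact: continuous_val.
- by apply: open_comp => // x _; exact: continuous_val.
- by rewrite -preimage_setI AB preimage_set0.
Qed.

Lemma continuous_model_point t : continuous (model_point t).
Proof.
move=> y; have cl : continuous (fun y => clamp (const_mx 0) (const_mx 1) y : 'rV[R]_n).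
  exact: continuous_clamp.
have pt w : model_point t w = model_point t (clamp (const_mx 0) (const_mx 1) w).
  by apply: val_inj; rewrite [RHS]val_model_point //; exact: clamp_unit_cube.
apply: continuous_to_model => [|chi].
  rewrite (_ : position \o model_point t = clamp (const_mx 0) (const_mx 1)) //; last first.
    by apply/funext => w; rewrite /= pt position_point //; exact: clamp_unit_cube.
  exact: cl.
rewrite (_ : (fun _ => _) = (fun y => F2sign R (pairing t chi) *
   \prod_(F | pairing (lam F) chi != 0) facet_dist F (clamp (const_mx 0) (const_mx 1) y))).
  apply: continuous_scale.
  apply: continuous_prod_at => F _; apply: (@continuous_comp _ _ _ _ (facet_dist F)).
    exact: cl.
  exact: continuous_facet_dist.
by apply/funext => w; rewrite pt fiber_coord_point //; exact: clamp_unit_cube.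
Qed.

Lemma model_compact : compact [set: model].
Proof.
rewrite (_ : [set: model] =
  \big[setU/set0]_(t : 'rV['F_2]_n) (model_point t @` cube (R := R) (n := n))).
  apply: bigsetU_compact => t _; apply: continuous_compact; last exact: compact_cube.
  exact/continuous_subspaceT/continuous_model_point.
apply/seteqP; split=> // m _; have [t [y [cy ->]]] := model_pointP m.
by rewrite -bigcup_seq; exists t; [rewrite /= mem_index_enum | exists y].
Qed.

Lemma model_second_countable : @second_countable model.
Proof.
(* The pseudometric of the ambient space makes the compact model second
   countable. *)
pose P : pseudoMetricType R := set_type model_set.
pose T : pseudoPMetricType R := HB.pack (PseudoMetric.sort P)
  (isPointed.Build (PseudoMetric.sort P) (model_point 0 0)).
exact: (@compact_second_countable R T model_compact).
Qed.

(** The element t0 with m = model_point t0 (position m) is only determined up to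
the isotropy group, which does not matter for the result. *)
Definition model_act t (m : model) : model :=
  model_point (t + xget 0 [set t' | m = model_point t' (position m)]) (position m).

Lemma model_point_eq t t' y : cube y ->
  (forall chi, fiber_val lam t y chi = fiber_val lam t' y chi) ->
  model_point t y = model_point t' y.
Proof.
move=> cy e; apply: model_ext; first by rewrite !position_point.
by move=> chi; rewrite !fiber_coord_point.
Qed.

Lemma model_act_point t t' y :
  cube y -> model_act t (model_point t' y) = model_point (t + t') y.
Proof.
move=> cy; rewrite /model_act position_point //; apply: model_point_eq => // chi.
rewrite !fiber_val_act; congr (_ * _); rewrite -!fiber_coord_point //; congr fiber_coord.
have := @xgetPex _ 0 [set t'' | model_point t' y = model_point t'' y].
by move=> H; rewrite -H //; exists t'.
Qed.

Lemma fiber_coord_act t m chi :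
  fiber_coord (model_act t m) chi = F2sign R (pairing t chi) * fiber_coord m chi.
Proof.
have [t' [y [cy ->]]] := model_pointP m.
by rewrite model_act_point // !fiber_coord_point // fiber_val_act.
Qed.

Lemma position_act t m : position (model_act t m) = position m.
Proof.
have [t' [y [cy ->]]] := model_pointP m.
by rewrite model_act_point // !position_point.
Qed.

Lemma model_act0 m : model_act 0 m = m.
Proof.
have [t' [y [cy ->]]] := model_pointP m.
by rewrite model_act_point // add0r.
Qed.

Lemma model_actD s t m : model_act (s + t) m = model_act s (model_act t m).
Proof.
have [t' [y [cy ->]]] := model_pointP m.
by rewrite !model_act_point // addrA.
Qed.

Lemma continuous_model_act t : continuous (model_act t).
Proof.
move=> m; apply: continuous_to_model => [|chi].
  rewrite (_ : position \o _ = position); first exact: continuous_position.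
  by apply/funext => w; rewrite /= position_act.
rewrite (_ : (fun _ => _) = (fun m => F2sign R (pairing t chi) * fiber_coord m chi)).
  apply: continuous_scale.
  exact: continuous_fiber_coord.
by apply/funext => w; rewrite fiber_coord_act.
Qed.

Definition model_action : Z2_action n model :=
  Z2Action model_act0 model_actD continuous_model_act.

End Model.

(** * Locally affine functions are smooth *)

Section LocallyAffine.
Variables (R : realType) (n : nat).

Definition affine_coord (i : 'I_n) (c d : R) : 'rV[R]_n -> R^o := fun x => c * x 0 i + d.

(** In the model each new coordinate depends on a single old one, up to locally
constant signs. *)
Definition locally_affine (A : set 'rV[R]_n) (f : 'rV[R]_n -> R^o) :=
  forall x, A x -> exists i c d, \forall y \near x, f y = affine_coord i c d y.

Lemma continuous_affine_coord i c d : continuous (affine_coord i c d).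
Proof.
move=> x; apply: (@continuous_comp _ _ _ (fun y : 'rV[R]_n => y 0 i) (fun u : R => c * u + d)).
  exact: continuous_coord.
by apply: cvgD; [apply: cvgM; [exact: cvg_cst | exact: cvg_id] | exact: cvg_cst].
Qed.

Lemma is_derive_affine_coord i c d (x w : 'rV[R]_n) :
  is_derive x w (affine_coord i c d) (c * w 0 i).
Proof.
suff lim : (fun h : R => h^-1 *: ((affine_coord i c d \o shift x) (h *: w) -
    affine_coord i c d x)) @ 0^' --> (c * w 0 i : R^o).
  by apply: DeriveDef; [apply/cvg_ex; exists (c * w 0 i) | exact: cvg_lim lim].
set F := fun h : R => _.
have FE : \forall h \near (0 : R)^', (c * w 0 i : R^o) = F h.
  have := @nbhs_dnbhs_neq R 0; apply: filterS => h h0.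
  rewrite /F /affine_coord /= !mxE opprD addrACA subrr addr0 mulrDr -addrA subrr addr0.
  by rewrite /GRing.scale /= mulrCA mulrA mulrA mulfVK.
exact: cvg_trans (near_eq_cvg FE) (cvg_cst _).
Qed.

(** The partial derivatives are locally constant, hence again locally affine. *)
Lemma locally_affine_Ck (A : set 'rV[R]_n) (f : 'rV[R]_n -> R^o) k :
  locally_affine A f -> Ck_on k A f.
Proof.
have cont g : locally_affine A g -> forall x, A x -> {for x, continuous g}.
  move=> gA x Ax; have [i [c [d gx]]] := gA x Ax.
  exact: (near_eq_continuous gx (@continuous_affine_coord i c d x)).
elim: k f => [|k IH] f fA /=; split=> //; try exact: cont.
move=> j; split=> [x Ax|].
  have [i [c [d fx]]] := fA x Ax.
  apply: (@near_eq_derivable _ _ _ (affine_coord i c d)).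
    by apply: near_mono fx => y ->.
  by have [] := is_derive_affine_coord i c d x 'e_j.
apply: IH => x Ax; have [i [c [d fx]]] := fA x Ax.
exists i, 0, (c * ('e_j : 'rV[R]_n) 0 i).
have : \forall y \near x, \forall z \near y, f z = affine_coord i c d z.
  by apply: near_mono (nbhs_interior fx) => y.
apply: near_mono => y fy; rewrite (near_eq_derive _ fy) /affine_coord mul0r add0r.
by have [_ ->] := is_derive_affine_coord i c d y 'e_j.
Qed.

End LocallyAffine.

(** * The flat atlas *)

Lemma continuous_mul_at (R : realType) (T : topologicalType) (f g : T -> R) x :
  {for x, continuous f} -> {for x, continuous g} ->
  {for x, continuous (fun y => f y * g y)}.
Proof. by move=> cf cg; apply: cvgM. Qed.

Lemma continuous_inv_at (R : realType) (T : topologicalType) (f : T -> R) x :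
  f x != 0 -> {for x, continuous f} -> {for x, continuous (fun y => (f y)^-1)}.
Proof. by move=> f0 cf; apply: cvgV. Qed.

Section ModelCharts.
Variables (R : realType) (n : nat) (lam : char_fun n).
Hypothesis lam_char : is_char lam.
Implicit Types (y z : 'rV[R]_n) (t : 'rV['F_2]_n) (chi : 'cV['F_2]_n).
Implicit Type v : {ffun 'I_n -> bool}.
Local Notation model := (model R lam).
Local Notation position := (@position R n lam).
Local Notation model_point := (@model_point R n lam).

(** The points over the open star of the vertex v. *)
Definition star_dom v : set model :=
  [set m | forall j, facet_dist (far_facet v j) (position m) != 0].

Definition star_cod : set 'rV[R]_n := [set z | forall j, -1 < z 0 j < 1].

(** By chart_formula_dual the quotient is the i-th signed distance. *)
Definition star_map v (m : model) : 'rV[R]_n :=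
  \row_i (fiber_coord m (dual_chi lam v i) /
    \prod_(j | pairing (lam (far_facet v j)) (dual_chi lam v i) != 0)
      facet_dist (far_facet v j) (position m)).

Definition star_inv v z : model := model_point (fold_elt lam v z) (fold_point v z).

Lemma star_map_point v t y : cube y -> (forall j, facet_dist (far_facet v j) y != 0) ->
  star_map v (model_point t y) = signed_dist lam v t y.
Proof.
move=> cy dy; apply/rowP => i; rewrite mxE fiber_coord_point // position_point //.
rewrite (fiber_val_chart lam_char v) chart_formula_dual //.
by rewrite mulfK //; apply/prodf_neq0 => j _.
Qed.

Lemma star_cod_cube v z : star_cod z -> cube (fold_point v z).
Proof.
move=> zc; apply: fold_point_cube => j.
by rewrite ler_norml !ltW //; have /andP[] := zc j.
Qed.

Lemma star_dom_open v : open (star_dom v).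
Proof.
have -> : star_dom v =
  (fun m : model => \prod_j facet_dist (far_facet v j) (position m)) @^-1`
    [set u | u != 0].
  apply/seteqP; split=> m /= H; first by apply/prodf_neq0 => j _; exact: H.
  by move/prodf_neq0 : H => H j; exact: H.
apply: open_comp; last exact: open_neq.
move=> m _; apply: continuous_prod_at => j _.
apply: (@continuous_comp _ _ _ position (facet_dist (far_facet v j))).
  exact: continuous_position.
exact: continuous_facet_dist.
Qed.

Lemma star_cod_open : open star_cod.
Proof.
rewrite openE => z zc; apply: (near_all (P := fun j (z : 'rV[R]_n) => -1 < z 0 j < 1)) => j.
have : open [set u : R | -1 < u < 1].
  rewrite (_ : [set _ | _] = `]-1, 1[%classic); first exact: itv_open.
  by apply/seteqP; split=> u; rewrite /= in_itv.
move=> o; have := near_comp (continuous_coord (i := j) (x := z)) (near_open o (zc j)); exact.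
Qed.

Lemma star_map_cod v m : star_dom v m -> star_cod (star_map v m).
Proof.
have [t [y [cy ->]]] := model_pointP m; rewrite /star_dom /= position_point // => dy j.
rewrite star_map_point // signed_distE -ltr_norml normrM normr_F2sign mul1r.
have /andP[d0 _] := facet_dist_itv (near_facet v j) cy; rewrite ger0_norm //.
have /andP[f0 _] := facet_dist_itv (far_facet v j) cy.
have : 0 < facet_dist (far_facet v j) y by rewrite lt_def dy.
by rewrite facet_dist_far subr_gt0.
Qed.

Lemma star_inv_dom v z : star_cod z -> star_dom v (star_inv v z).
Proof.
move=> zc j; rewrite position_point; last exact: star_cod_cube.
by rewrite facet_dist_far facet_dist_fold subr_eq0 gt_eqF // ltr_norml.
Qed.

Lemma star_mapK v m : star_dom v m -> star_inv v (star_map v m) = m.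
Proof.
have [t [y [cy ->]]] := model_pointP m; rewrite /star_dom /= position_point // => dy.
rewrite star_map_point // /star_inv fold_point_signed //; apply: model_point_eq => // chi.
rewrite !(fiber_val_chart lam_char v).
by rewrite -{2}(fold_point_signed lam v t cy) signed_dist_fold.
Qed.

Lemma star_invK v z : star_cod z -> star_map v (star_inv v z) = z.
Proof.
move=> zc; have cf := star_cod_cube v zc.
rewrite star_map_point ?signed_dist_fold // => j.
by have := star_inv_dom v zc j; rewrite position_point.
Qed.

Lemma star_map_cont v m : star_dom v m -> {for m, continuous (star_map v)}.
Proof.
move=> dm; apply: continuous_row => i.
have <- : (fun m : model => fiber_coord m (dual_chi lam v i) /
    \prod_(j | pairing (lam (far_facet v j)) (dual_chi lam v i) != 0)
      facet_dist (far_facet v j) (position m)) = (fun m => star_map v m 0 i).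
  by apply/funext => w; rewrite mxE.
apply: continuous_mul_at; first exact: continuous_fiber_coord.
apply: continuous_inv_at; first by apply/prodf_neq0 => j _; exact: dm.
apply: continuous_prod_at => j _.
apply: (@continuous_comp _ _ _ position (facet_dist (far_facet v j))).
  exact: continuous_position.
exact: continuous_facet_dist.
Qed.

(** On the chart the coordinates of the ambient space are the polynomials of
chart_formula in z and the absolute values of its entries. *)
Lemma star_inv_cont v z : star_cod z -> {for z, continuous (star_inv v)}.
Proof.
move=> zc; have near_cod : \forall w \near z, star_cod w.
  by apply: near_open => //; exact: star_cod_open.
apply: continuous_to_model => [|chi].
  apply: (@near_eq_continuous _ _ _ (fold_point v)); last exact: continuous_fold_point.
  by apply: near_mono near_cod => w wc; rewrite /= position_point //; exact: star_cod_cube.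
apply: (@near_eq_continuous _ _ _ (fun w => chart_formula lam v w (fold_point v w) chi)).
  apply: near_mono near_cod => w wc; rewrite fiber_coord_point; last exact: star_cod_cube.
  by rewrite (fiber_val_chart lam_char v) signed_dist_fold.
apply: continuous_mul_at.
  by apply: continuous_prod_at => j _; exact: continuous_coord.
apply: continuous_prod_at => j _.
apply: (@continuous_comp _ _ _ (fold_point v) (facet_dist (far_facet v j))).
  exact: continuous_fold_point.
exact: continuous_facet_dist.
Qed.

Definition star_chart v : chart R n model :=
  Chart (star_dom_open v) star_cod_open (@star_map_cod v) (@star_inv_dom v)
    (@star_mapK v) (@star_invK v) (@star_map_cont v) (@star_inv_cont v).

Lemma near_sign (x : R) : x != 0 ->
  \forall u \near x, (u < 0) = (x < 0) /\ `|u| = F2sign R (x < 0)%R%:R * u.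
Proof.
rewrite neq_lt => /orP[x0|x0].
  have o : open [set u : R | u < 0] by exact: open_lt.
  have := near_open o x0.
  by apply: near_mono => u /= u0; rewrite u0 x0 ltr0_norm // F2sign1 mulN1r.
have o : open [set u : R | 0 < u] by exact: open_gt.
have := near_open o x0.
apply: near_mono => u /= u0; rewrite !ltNge (ltW u0) (ltW x0) gtr0_norm //.
by rewrite F2sign0 mul1r.
Qed.

(** Let z be in the chart around v and also over the star of w.  Then z j is nonzero
in the directions j in which v and w differ, so its sign is constant near z.  In
the other directions the bases at v and w share the vector lam (j, v j).  Hence
up to a locally constant sign e the i-th new coordinate is z i if v and w agree
at i, and 1 - |z i| otherwise. *)
Lemma star_transition v w : smooth_transition (star_chart v) (star_chart w).
Proof.
move=> i k; apply: locally_affine_Ck => z [/= zc zw].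
pose diff := [pred j | v j != w j].
have z0 j : diff j -> z 0 j != 0.
  move=> vw; have := zw j; rewrite position_point; last exact: star_cod_cube.
  have -> : far_facet w j = near_facet v j.
    by move: vw => /=; rewrite /far_facet /near_facet; case: (v j) (w j) => [] [].
  by rewrite facet_dist_fold normr_eq0.
pose B := vertex_mx lam v *m invmx (vertex_mx lam w).
have B_same j : v j = w j -> B j i = (i == j)%:R.
  move=> vw; have := pairing_near_dual lam_char w i j.
  rewrite pairing_dual /vertex_coords /near_facet -vw.
  rewrite -[lam _](rowK (fun j => lam (j, v j))) => <-.
  by rewrite -row_mul [RHS]mxE.
(* The part of the sign that is constant near z. *)
pose K x := \sum_(j | diff j) ((x : 'rV[R]_n) 0 j < 0)%R%:R * B j i.
have coordE x : vertex_coords lam w (fold_elt lam v x) 0 i =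
    (if v i == w i then (x 0 i < 0)%R%:R else 0) + K x.
  rewrite /vertex_coords /fold_elt -mulmxA mxE -/B (bigID diff) [LHS]addrC /=; congr (_ + _).
    have [viwi|viwi] := eqVneq (v i) (w i).
      rewrite (bigD1 i) /=; last by rewrite viwi eqxx.
      rewrite [X in _ + X]big1 ?addr0; last first.
        move=> j /andP[/negPn/eqP vw ji]; rewrite B_same // eq_sym (negPf ji).
        by rewrite mulr0.
      by rewrite B_same // eqxx mulr1 mxE inE.
    rewrite big1 // => j /negPn/eqP vw; rewrite B_same // (_ : (i == j) = false) ?mulr0 //.
    by apply/negbTE; apply: contra viwi => /eqP->; rewrite vw.
  by apply: eq_bigr => j _; rewrite mxE inE.
have near_signs : \forall x \near z, forall j, diff j ->
    ((x : 'rV[R]_n) 0 j < 0) = (z 0 j < 0) /\ `|x 0 j| = F2sign R (z 0 j < 0)%R%:R * x 0 j.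
  apply: near_all => j; have [vw|vw] := boolP (diff j); last exact: near_always.
  have := near_comp (continuous_coord (i := j) (x := z)) (near_sign (z0 _ vw)).
  by apply: near_mono.
have near_cod : \forall x \near z, star_cod x.
  by apply: near_open => //; exact: star_cod_open.
have near_dom : \forall x \near z, star_dom w (star_inv v x).
  apply: near_comp; first exact: star_inv_cont.
  by apply: near_open => //; exact: star_dom_open.
pose e := F2sign R (K z).
have trans : \forall x \near z, (star_map w \o star_inv v) x 0 i =
    F2sign R (if v i == w i then (x 0 i < 0)%R%:R else 0) * e *
    facet_dist (near_facet w i) (fold_point v x).
  apply: near_mono (near_and near_cod (near_and near_dom near_signs)) => x [xc [xd xs]].
  have cf := star_cod_cube v xc.
  rewrite /= /star_inv star_map_point // => [|j]; last first.
    by have := xd j; rewrite position_point.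
  rewrite signed_distE coordE F2signD; congr (_ * _ * _); rewrite /e; congr F2sign.
  by apply: eq_bigr => j dj; have [-> _] := xs j dj.
have [viwi|viwi] := eqVneq (v i) (w i).
  exists i, e, 0; apply: near_mono trans => x ->; rewrite viwi eqxx /affine_coord addr0.
  have -> : facet_dist (near_facet w i) (fold_point v x) = `|x 0 i|.
    by rewrite -(facet_dist_fold v) /near_facet viwi.
  by rewrite mulrAC F2sign_neg mulrC.
exists i, (- e * F2sign R (z 0 i < 0)%R%:R), e.
apply: near_mono (near_and trans near_signs) => x [-> xs]; rewrite (negPf viwi) F2sign0 mul1r.
have -> : near_facet w i = far_facet v i.
  by move: viwi; rewrite /far_facet /near_facet; case: (v i) (w i) => [] [].
rewrite facet_dist_far facet_dist_fold (xs i viwi).2 /affine_coord mulrBr mulr1 mulNr mulNr.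
by rewrite addrC mulrA.
Qed.

Lemma star_cover (m : model) : exists v, star_dom v m.
Proof. by have [v vm] := near_vertex (position m); exists v. Qed.

Definition model_mfd : smooth_manifold R n.
Proof.
apply: (@SmoothManifold R n model (@model_hausdorff R n lam)
  (@model_second_countable R n lam) (range star_chart)).
- by move=> m; have [v vm] := star_cover m; exists (star_chart v) => //; exists v.
- by move=> c d [v _ <-] [w _ <-]; exact: star_transition.
Defined.

Definition model_mfd_action : Z2_action n model_mfd := model_action R lam.

(** In the basis at v the element t acts by the signs of its coordinates. *)
Lemma star_chart_standard v : standard_chart model_mfd_action (star_chart v).
Proof.
split; first by move=> d [w _ <-]; split; exact: star_transition.
exists (mulmxr (invmx (vertex_mx lam v))); split.
  exists (mulmx^~ (vertex_mx lam v)) => t /=.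
    by rewrite mulmxKV // vertex_unit.
  by rewrite mulmxK // vertex_unit.
move=> t m dm; have dtm : star_dom v (model_act t m) by move=> j; rewrite position_act.
split=> //; have [t' [y [cy mE]]] := model_pointP m; rewrite mE in dm dtm *.
have dy j : facet_dist (far_facet v j) y != 0 by have := dm j; rewrite position_point.
change (star_map v (model_act t (model_point t' y)) =
  standard_act (vertex_coords lam v t) (star_map v (model_point t' y))).
rewrite model_act_point // !star_map_point //; apply/rowP => j.
rewrite [LHS]signed_distE.
have -> : vertex_coords lam v (t + t') 0 j =
    vertex_coords lam v t 0 j + vertex_coords lam v t' 0 j.
  by rewrite vertex_coordsD mxE.
rewrite [RHS]mxE signed_distE F2signD.
by rewrite /F2sign; case: eqP => _; rewrite -?mulrA ?mul1r ?mulN1r.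
Qed.

(** Over the star of v the facets through a point are among those through v, and
the chart coordinates vanish exactly on them. *)
Lemma star_chart_codim v m : star_dom v m ->
  cube_codim (position m) = orthant_codim (star_map v m).
Proof.
have [t [y [cy ->]]] := model_pointP m; rewrite /star_dom /= position_point // => dy.
rewrite star_map_point // cube_codimE.
have inj : injective (near_facet v) by move=> i j [].
rewrite /orthant_codim -(card_imset _ inj); apply: eq_card => F.
apply/idP/imsetP => [Fy|[j + ->]]; last first.
  rewrite inE signed_distE mulf_eq0 facet_dist_eq0 => /orP[|//].
  by rewrite -normr_eq0 normr_F2sign oner_eq0.
have FE : F = near_facet v F.1.
  case: F Fy => i b iby; rewrite /near_facet /=.
  have [<- //|bv] := eqVneq b (v i).
  have := dy i; rewrite facet_dist_eq0 (_ : far_facet v i = (i, b)) ?iby //.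
  by rewrite /far_facet; case: (b) (v i) bv => [] [].
exists F.1 => //; rewrite inE signed_distE mulf_eq0 facet_dist_eq0 -FE.
by rewrite Fy orbT.
Qed.

Lemma model_locally_standard : locally_standard model_mfd_action.
Proof.
move=> m; have [v vm] := star_cover m; exists (star_chart v) => //.
exact: star_chart_standard.
Qed.

Lemma model_stab t m : model_act t m = m <->
  exists2 S : {set facet n}, S \subset facets_at (position m) & t = \sum_(F in S) lam F.
Proof.
have [t' [y [cy ->]]] := model_pointP m.
rewrite model_act_point // position_point // -(stab_fiber_val lam_char).
split=> [e chi|e]; last first.
  apply: model_point_eq => // chi; rewrite addrC fiber_val_act e -fiber_val_act.
  by rewrite addr0.
have := congr1 (fun m : model => fiber_coord m chi) e.
rewrite /= !fiber_coord_point // fiber_val_act.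
rewrite -{1 2}[t']addr0 !fiber_val_act => h.
rewrite -[t]addr0 fiber_val_act.
apply: (can_inj (mulKf _))
  (_ : F2sign R (pairing t' chi) * _ = F2sign R (pairing t' chi) * _).
  by rewrite -normr_eq0 normr_F2sign oner_eq0.
by rewrite mulrCA.
Qed.

(** The space is compact, so the projection to the cube is a closed map, hence a
quotient map.  For an arbitrary standard chart the codimension is read off from
the isotropy group, as for the charts around the vertices. *)
Lemma model_orbit_map : orbit_map_onto_cube model_mfd_action position.
Proof.
split.
- exact: continuous_position.
- apply/seteqP; split=> [_ [m _ <-]|y cy]; first exact: position_cube.
  by exists (model_point 0 y); rewrite ?position_point.
- move=> m m'; split=> [|[t <-]]; last by rewrite position_act.
  have [t [y [cy ->]]] := model_pointP m; have [t' [y' [cy' ->]]] := model_pointP m'.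
  rewrite !position_point // => <-; exists (t + t').
  by rewrite [LHS]model_act_point // addrC addrA F2rowDD add0r.
- move=> V oV; exists (~` (position @` (~` (position @^-1` V)))).
    apply: closed_openC; apply: compact_closed; first exact: hausdorff_row.
    apply: continuous_compact; first exact/continuous_subspaceT/continuous_position.
    apply: (@subclosed_compact _ _ [set: model]) => //; first exact: (open_closedC oV).
    exact: model_compact.
  apply/seteqP; split=> y [Wy cy]; split=> //.
    apply: contrapT => Vy; apply: Wy; exists (model_point 0 y); last by rewrite position_point.
    by rewrite /preimage /= position_point.
  by case=> m nVm my; apply: nVm; rewrite /preimage /= my.
move=> c m sc cm; have [v vm] := star_cover m; rewrite (star_chart_codim vm).
have [_ [al [alb alE]]] := sc.
have [_ [be [beb beE]]] := star_chart_standard v.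
have := card_stab alE cm alb; rewrite (card_stab beE vm beb) => /eqP.
by rewrite eqn_exp2l // => /eqP.
Qed.

Definition model_small_cover : small_cover_over_cube R n :=
  @SmallCoverOverCube R n model_mfd (@model_compact R n lam) model_mfd_action
    model_locally_standard (ex_intro _ position model_orbit_map).

Lemma model_char_fun : char_fun_for model_mfd_action position lam.
Proof. by split => // m t; exact: model_stab. Qed.

End ModelCharts.

(** * The classification and the count *)

Definition char_orbit n (lam : char_fun n) := orbit (relabel_action n) (cube_aut n) lam.

Lemma char_orbit_eqP n (lam mu : char_fun n) :
  char_orbit lam = char_orbit mu <-> exists2 s, s \in cube_aut n & mu = relabel lam s.
Proof.
split=> [e|[s sA ->]].
  have : mu \in char_orbit lam by rewrite e; exact: orbit_refl.
  by case/fingroup.action.orbitP => s sA <-; exists s.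
by apply/esym/orbit_eqP/mem_orbit.
Qed.

Section Classes.
Variables (R : realType) (n : nat).

Definition has_char_fun (M : small_cover_over_cube R n) (lam : char_fun n) :=
  exists2 p, orbit_map_onto_cube (sc_act M) p & char_fun_for (sc_act M) p lam.

Lemma small_cover_char_fun M : exists lam, has_char_fun M lam.
Proof.
have [p pP] := sc_orbit_space M.
have [lam lamP] := exists_char_fun (@sc_locally_standard _ _ M) pP.
by exists lam, p.
Qed.

Lemma homeomorphic_char_orbit M N lam mu : has_char_fun M lam -> has_char_fun N mu ->
  equivariantly_homeomorphic M N <-> char_orbit lam = char_orbit mu.
Proof.
move=> [p pP lamP] [q qP muP]; rewrite char_orbit_eqP; split=> [[f [g]]|[s sA muE]].
  case=> fK gK cf cg fE.
  exact: (homeomorphic_relabel (@sc_locally_standard _ _ M)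
    (@sc_locally_standard _ _ N) pP qP lamP muP fK gK cf cg fE).
exact: (relabel_homeomorphic pP qP lamP muP sA muE).
Qed.

Lemma equivariantly_homeomorphic_refl (M : small_cover_over_cube R n) :
  equivariantly_homeomorphic M M.
Proof. by exists id, id; split=> // x U. Qed.

(** The class of a small cover is the index of the orbit of its characteristic
function. *)
Lemma num_small_cover_classes :
  num_classes (@equivariantly_homeomorphic R n)
    #|orbit (relabel_action n) (cube_aut n) @: char_funs n|.
Proof.
have /choice[lam lamP] := small_cover_char_fun.
set O := _ @: _.
have lamO M : char_orbit (lam M) \in O.
  by apply: imset_f; rewrite inE; have [p _ []] := lamP M.
pose cls M := enum_rank_in (lamO M) (char_orbit (lam M)).
have clsE M : enum_val (cls M) = char_orbit (lam M) by rewrite enum_rankK_in.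
exists cls; split=> [i|M N].
  have /imsetP[mu] := enum_valP i; rewrite inE => mu_char mu_orb.
  have mod_mu : has_char_fun (model_small_cover R mu_char) mu.
    by exists (@position R n mu); [exact: model_orbit_map | exact: model_char_fun].
  exists (model_small_cover R mu_char); apply: enum_val_inj; rewrite clsE [RHS]mu_orb.
  apply/(homeomorphic_char_orbit (lamP _) mod_mu).
  exact: equivariantly_homeomorphic_refl.
rewrite (homeomorphic_char_orbit (lamP M) (lamP N)) -!clsE.
by split=> [->|/enum_val_inj].
Qed.

End Classes.

Theorem theorem3p3 (R : realType) (n : nat) (hn : (0 < n)%N) :
  exists Q : nat,
    num_classes (@equivariantly_homeomorphic R n) Q /\
    Q%:R = (\sum_(0 <= k < n.+1)
              'C(n, k)%:R * 2 ^+ (k * (n - k)) * (num_acyclic_digraphs k)%:R)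
           / (2 ^+ n * n`!%:R)
           * \prod_(0 <= i < n) (2 ^+ n - 2 ^+ i) :> rat.
Proof.
exists #|orbit (relabel_action n) (cube_aut n) @: char_funs n|.
by split; [exact: num_small_cover_classes | exact: num_char_orbits].
Qed.
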